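(* Let $c_0,c_1,c_2,c_3\in\mathbb{C}$ and consider the infinitesimal deformation of the standard embedding $$f\partial\longmapsto f\xi+c_0\theta_0(f\partial)+c_1\theta_1(f\partial)+c_2\theta_2(f\partial)+c_3\theta_3(f\partial).$$ This infinitesimal deformation corresponds to a polynomial deformation of the standard embedding $\pi:\mathrm{Vect}(S^1)\to\Psi\mathrm{D}(S^1)$ if and only if $$\begin{array}{l}6c_1^3c_3-3c_1^2c_2^2-18c_1c_2c_3+8c_2^3+9c_3^2+3c_1^3c_2-6c_1c_2^2\\ \qquad -9c_1^2c_3+18c_2c_3+3c_1c_3-5c_1^2c_2+8c_2^2+2c_1c_2=0.\end{array}$$
   Context: $\mathrm{Vect}(S^1)$ is the Lie algebra of smooth vector fields $f\partial$, $\partial=d/dx$, on the circle, with $[f\partial,g\partial]=(fg'-f'g)\partial$. $\Psi\mathrm{D}(S^1)$ is the space of formal series $F=\sum_{k\in\mathbb{Z}}f_k(x)\xi^k$ with $f_k\in C^\infty(S^1)$ complex-valued and $f_k=0$ for all sufficiently large $k$, with the associative product $$F\circ G=\sum_{k\ge0}\frac1{k!}\,\partial_\xi^kF\;\partial_x^kG,$$ where products on the right are those of commuting variables, i.e. $(f\xi^k)(g\xi^\ell)=fg\,\xi^{k+\ell}$. It is a Lie algebra under $[F,G]=F\circ G-G\circ F$. The standard embedding is $\pi(f\partial)=f\xi$. The 1-cocycles $\theta_i:\mathrm{Vect}(S^1)\to\Psi\mathrm{D}(S^1)$ (for the action $X\cdot F=[\pi(X),F]$) are $$\theta_0(f\partial)=f,\qquad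 \theta_1(f\partial)=f',$$ $$\theta_2(f\partial)=\sum_{n\ge2}(-1)^{n-1}\frac{2(n-3)}{n}f^{(n)}\xi^{-n+1},\qquad \theta_3(f\partial)=\sum_{n\ge2}(-1)^{n}\frac{3(n-1)}{n+1}f^{(n+1)}\xi^{-n},$$ so the expansions of $\theta_2$ and $\theta_3$ begin with $f''\xi^{-1}$ and $f'''\xi^{-2}$. A polynomial deformation of $\pi$ is a family of Lie algebra homomorphisms $\widetilde\pi(t)=\pi+\sum_{k\in\mathbb{Z}}\widetilde\pi_k(t)\xi^k:\mathrm{Vect}(S^1)\to\Psi\mathrm{D}(S^1)$, $t\in\mathbb{C}^n$ for some $n$, where each linear map $\widetilde\pi_k(t):\mathrm{Vect}(S^1)\to C^\infty(S^1)$ depends polynomially on $t$, $\widetilde\pi_k(0)=0$, and $\widetilde\pi_k\equiv0$ for all sufficiently large $k$. The infinitesimal deformation with parameters $(c_0,c_1,c_2,c_3)$ is said to correspond to a polynomial deformation if there are a polynomial deformation $\widetilde\pi(t)$ and a parameter value $t_*$ such that $$\widetilde\pi(t_* )(f\partial)=f\xi+c_0f+c_1f'+\sum_{k\ge1}A_k(f)\,\xi^{-k},$$ where each $A_k$ is a constant-coefficient linear differential operator, the coefficient of $f''$ in $A_1(f)$ is $c_2$, and the coefficient of $f'''$ in $A_2(f)$ is $c_3$. *)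

(* Defs.v *)
From HB Require Import structures.
From mathcomp Require Import all_boot all_order all_algebra.
From mathcomp Require Import complex.
From mathcomp Require Import all_classical all_reals all_analysis.
Set Implicit Arguments.
Unset Strict Implicit.
Unset Printing Implicit Defensive.
Import Order.TTheory GRing.Theory Num.Theory.
Import numFieldNormedType.Exports.
Local Open Scope classical_set_scope.
Local Open Scope ring_scope.
Local Open Scope complex_scope.

Section Definitions.
Variable R : realType.
Local Notation C := R[i].

Implicit Types (f g : R -> R) (u : R -> C).

Definition smooth f := forall n x, derivable (derive1n n f) x 1.

(* The circle is R / 2 pi Z: functions on it are 2 pi-periodic functions on the
   line. A function f in vect_S1 stands for the (real) vector field f d/dx. *)
Definition vect_S1 : set (R -> R) := [set f | periodic f (2 * pi) /\ smooth f].

Definition vbracket f g : R -> R := f * derive1 g - derive1 f * g.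

Definition cfun_S1 : set (R -> C) :=
  [set u | [/\ periodic u (2 * pi), smooth (@complex.Re R \o u)
             & smooth (@complex.Im R \o u)]].

Definition cderiv u : R -> C :=
  fun x => derive1 (@complex.Re R \o u) x +i* derive1 (@complex.Im R \o u) x.

(* F : symbol is the formal series whose coefficient of xi^k is F k. *)
Definition symbol := int -> R -> C.
Implicit Types F G : symbol.

Definition psiD : set symbol :=
  [set F | (forall k, cfun_S1 (F k)) /\
           exists K : int, forall k, K < k -> F k = 0].

Definition dx F : symbol := fun k => cderiv (F k).

Definition dxi F : symbol := fun k x => (k + 1)%:~R * F (k + 1) x.

(* The sums below are sums over finite supports when F and G are in psiD. *)
Definition smul F G : symbol :=
  fun m x => \sum_(k \in [set: int]) (F k x * G (m - k) x).

Definition scomp F G : symbol :=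
  fun m x => \sum_(k \in [set: nat])
    ((k`!)%:R^-1 * smul (iter k dxi F) (iter k dx G) m x).

Definition sbracket F G : symbol := scomp F G - scomp G F.

Definition std_embedding f : symbol :=
  fun k x => if k == 1 then (f x)%:C else 0.

Definition theta0 f : symbol :=
  fun k x => if k == 0 then (f x)%:C else 0.

Definition theta1 f : symbol :=
  fun k x => if k == 0 then (derive1 f x)%:C else 0.

(* xi^k with k = - n + 1, n >= 2 *)
Definition theta2 f : symbol := fun k x =>
  if k <= -1 then
    let n := `|1 - k|%N in
    (-1) ^+ n.-1 * (2 * (n%:R - 3) / n%:R) * (derive1n n f x)%:C
  else 0.

(* xi^k with k = - n, n >= 2 *)
Definition theta3 f : symbol := fun k x =>
  if k <= -2 then
    let n := `|k|%N in
    (-1) ^+ n * (3 * (n%:R - 1) / (n%:R + 1)) * (derive1n n.+1 f x)%:C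
  else 0.

Definition infinitesimal_deformation (c0 c1 c2 c3 : C) f : symbol :=
  fun k x => std_embedding f k x + c0 * theta0 f k x + c1 * theta1 f k x
             + c2 * theta2 f k x + c3 * theta3 f k x.

(* Maps out of Vect(S^1) are given on all functions R -> R, but only their
   values on vect_S1 matter. *)
Definition linear_to_cfun (A : (R -> R) -> R -> C) :=
  (forall f, vect_S1 f -> cfun_S1 (A f)) /\
  (forall (a : R) f g, vect_S1 f -> vect_S1 g -> forall x,
     A (fun y => a * f y + g y) x = a%:C * A f x + A g x).

Definition lie_hom (phi : (R -> R) -> symbol) :=
  [/\ forall f, vect_S1 f -> psiD (phi f),
      forall (a : R) f g, vect_S1 f -> vect_S1 g -> forall k x,
        phi (fun y => a * f y + g y) k x = a%:C * phi f k x + phi g k x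
    & forall f g, vect_S1 f -> vect_S1 g ->
        phi (vbracket f g) = sbracket (phi f) (phi g)].

(* A polynomial in t \in C^n with coefficients P m in the space of linear maps
   Vect(S^1) -> C^oo(S^1); m ranges over the exponents of degree at most d in
   each variable. *)
Definition polynomial_family n (A : 'rV[C]_n -> (R -> R) -> R -> C) :=
  exists (d : nat) (P : {ffun 'I_n -> 'I_d.+1} -> (R -> R) -> R -> C),
    (forall m, linear_to_cfun (P m)) /\
    (forall t f, vect_S1 f -> forall x,
       A t f x = \sum_(m : {ffun 'I_n -> 'I_d.+1})
                 (\prod_(i < n) t 0 i ^+ m i) * P m f x).

(* std_embedding + \sum_k (p k t) xi^k *)
Definition deformed n (p : int -> 'rV[C]_n -> (R -> R) -> R -> C)
    (t : 'rV[C]_n) f : symbol :=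
  fun k x => std_embedding f k x + p k t f x.

Definition polynomial_deformation n
    (p : int -> 'rV[C]_n -> (R -> R) -> R -> C) :=
  [/\ forall t, lie_hom (deformed p t),
      forall k t, linear_to_cfun (p k t),
      forall k, polynomial_family (p k),
      forall k f, vect_S1 f -> p k 0 f = 0
    & exists K : int, forall k, K < k ->
        forall t f, vect_S1 f -> p k t f = 0].

(* The polynomial q stands for the constant-coefficient operator q(d/dx). *)
Definition diff_op (q : {poly C}) f : R -> C :=
  fun x => \sum_(j < size q) q`_j * (derive1n j f x)%:C.

(* f xi + c0 f + c1 f' + \sum_(k >= 1) A_k(f) xi^(-k) *)
Definition normal_form (c0 c1 : C) (A : nat -> {poly C}) f : symbol :=
  fun k x =>
    if k == 1 then (f x)%:C
    else if k == 0 then c0 * (f x)%:C + c1 * (derive1 f x)%:C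
    else if k < 0 then diff_op (A `|k|%N) f x
    else 0.

(* The parameters c0, ..., c3 are determined by phi. *)
Definition corresponds_to_polynomial_deformation
    (phi : (R -> R) -> symbol) :=
  exists c0 c1 c2 c3 : C,
    (forall f, vect_S1 f -> phi f = infinitesimal_deformation c0 c1 c2 c3 f) /\
    exists (n : nat) (p : int -> 'rV[C]_n -> (R -> R) -> R -> C),
      polynomial_deformation p /\
      exists (t : 'rV[C]_n) (A : nat -> {poly C}),
        [/\ forall f, vect_S1 f -> deformed p t f = normal_form c0 c1 A f,
            (A 1%N)`_2 = c2 & (A 2%N)`_3 = c3].

End Definitions.

(* Main.v *)
(** Write a translation-invariant map as phi(e^(px) d/dx) = e^(px) Phi(p, xi)
    with Phi(p, xi) = \sum_i Phi_i(p) xi^(1-i). It is a homomorphism iff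
      Phi(p, xi+q) Phi(q, xi) - Phi(q, xi+p) Phi(p, xi) = (q-p) Phi(p+q, xi).
    A three-parameter family of solutions is
      (xi+a+p)^mu (xi+a+lam p) (xi+a)^(-mu),
    and it realises c0 = a, c1 = mu + lam, c2 = C(mu,2) + lam mu and
    c3 = C(mu,3) + lam C(mu,2); eliminating mu and lam gives the polynomial of
    the theorem, and (t mu, t lam, t a) is the polynomial deformation.
    Conversely, for any solution in normal form the coefficients of p q^d force
    deg Phi_i <= i, and the coefficients of p^2 q^3, p^2 q^4, p^2 q^5 and
    p^3 q^4 give four equations for b_i = [p^i] Phi_i, i <= 6; eliminating
    b_4, b_5 and b_6 leaves the polynomial. *)
Require Import Defs.
From mathcomp Require Import all_boot all_order all_algebra.
From mathcomp Require Import complex.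
From mathcomp Require Import all_classical all_reals all_analysis.
From mathcomp Require Import ring zify.
Set Implicit Arguments.
Unset Strict Implicit.
Unset Printing Implicit Defensive.
Import Order.TTheory GRing.Theory Num.Theory.
Import numFieldNormedType.Exports.
Local Open Scope ring_scope.

(** The family is the action f xi + lam f' on densities, conjugated formally by xi^mu, which carries
    e^(px) to e^(px) (xi+p)^mu xi^(-mu), and by e^(ax), which translates xi by a. These conjugating
    factors need not lie in the algebra: xi^mu has a complex exponent and e^(ax) need not be
    periodic. So the bracket relation is checked on series in 1/xi, where translation is
    multiplicative and both orders of the product share the factor (xi+p+q)^mu xi^(-mu); what
    remains is the case mu = 0.

    The other obstacle is that [vect_S1] holds real smooth fields, not exponentials. A polynomial
    identity in p and q is applied to two real fields by pairing with their jets at a point, p^i q^j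
    becoming f^(i) g^(j). Conversely, cosines and sines of integer frequency, taken at the point 0,
    give all pairs of exponentials e^(imx), e^(inx) by complex bilinearity, and these frequencies
    are numerous enough to recover a polynomial in p and q. *)

Section GeneralizedBinomial.
Variable F : numFieldType.
Implicit Types x y : F.

Definition gbinom x k : F := (\prod_(i < k) (x - i%:R)) / k`!%:R.

Lemma gbinom0 x : gbinom x 0 = 1.
Proof. by rewrite /gbinom big_ord0 fact0 divr1. Qed.

Lemma gbinomS x k : k.+1%:R * gbinom x k.+1 = (x - k%:R) * gbinom x k.
Proof.
rewrite /gbinom big_ord_recr factS natrM /=.
have k1 : k.+1%:R != 0 :> F by rewrite pnatr_eq0.
have kf : k`!%:R != 0 :> F by rewrite pnatr_eq0 -lt0n fact_gt0.
by field; rewrite kf addrC natr1 k1.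
Qed.

Lemma gbinom1 x : gbinom x 1 = x.
Proof. by have := gbinomS x 0; rewrite gbinom0 mulr1 subr0 mul1r. Qed.

Lemma gbinom0S k : gbinom 0 k.+1 = 0 :> F.
Proof. by rewrite /gbinom big_ord_recl subrr !mul0r. Qed.

Lemma gbinom1SS k : gbinom 1 k.+2 = 0 :> F.
Proof. by rewrite /gbinom !big_ord_recl /= subrr !mul0r mulr0 mul0r. Qed.

(** Induction on [n] after multiplying by [n.+1]: in each term [n.+1] splits as [i] plus [n.+1 - i],
    [gbinomS] lowers the matching index, and the factors [x - i] and [y - (n - i)] add up to
    [x + y - n]. *)
Lemma gbinom_Vandermonde x y n :
  \sum_(i < n.+1) gbinom x i * gbinom y (n - i) = gbinom (x + y) n.
Proof.
elim: n => [|n IHn]; first by rewrite big_ord1 !gbinom0 mulr1.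
have n1 : n.+1%:R != 0 :> F by rewrite pnatr_eq0.
apply: (mulfI n1); rewrite gbinomS -IHn mulr_sumr [RHS]mulr_sumr.
transitivity (\sum_(i < n.+1) i.+1%:R * gbinom x i.+1 * gbinom y (n - i) +
    \sum_(i < n.+1) gbinom x i * ((n - i).+1%:R * gbinom y (n - i).+1)).
  transitivity (\sum_(i < n.+2) (i%:R * gbinom x i * gbinom y (n.+1 - i)) +
     \sum_(i < n.+2) (gbinom x i * ((n.+1 - i)%:R * gbinom y (n.+1 - i)))).
    rewrite -big_split; apply: eq_bigr => i _ /=.
    have -> : n.+1%:R = i%:R + (n.+1 - i)%:R :> F.
      by rewrite -natrD subnKC // -ltnS.
    by ring.
  congr (_ + _); first by rewrite big_ord_recl !mul0r add0r.
  rewrite big_ord_recr /= subnn mul0r mulr0 addr0.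
  by apply: eq_bigr => i _; rewrite subSn // -ltnS.
rewrite -big_split; apply: eq_bigr => i _ /=.
rewrite !gbinomS natrB; last by rewrite -ltnS.
by ring.
Qed.

(** The falling factorials of [x] and of [x - k] concatenate. This lets two successive translations
    compose in [shift_bseries]. *)
Lemma gbinom_trinomial x k j :
  gbinom x k * gbinom (x - k%:R) j = gbinom x (k + j) * 'C(k + j, k)%:R.
Proof.
rewrite /gbinom big_split_ord /=.
under [X in _ = (_ * X) / _ * _]eq_bigr => i _ do rewrite natrD opprD addrA.
rewrite -(bin_fact (leq_addr j k)) addKn !natrM.
have nz m : m`!%:R != 0 :> F by rewrite pnatr_eq0 -lt0n fact_gt0.
have bz : 'C(k + j, k)%:R != 0 :> F by rewrite pnatr_eq0 -lt0n bin_gt0 leq_addr.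
by field; rewrite !nz bz.
Qed.

End GeneralizedBinomial.

(** * Power series in 1/xi modulo a fixed order, and translations of xi *)

Section TruncatedSeries.
Variables (F : numFieldType) (K : comNzRingType) (iota : {rmorphism F -> K}).
Variable N : nat.
Implicit Types (p q : {poly K}) (s t d e : F) (a b : K).

(** Congruence modulo X^N, with X standing for 1/xi. A coefficient of a product or of a translate
    depends only on coefficients of at most the same index, so infinite expansions may be replaced
    by polynomials. *)
Definition eqN p q := forall n, (n < N)%N -> p`_n = q`_n.

Lemma eqN_refl p : eqN p p. Proof. by []. Qed.

Lemma eqN_sym p q : eqN p q -> eqN q p.
Proof. by move=> h n nN; rewrite h. Qed.

Lemma eqN_trans q p r : eqN p q -> eqN q r -> eqN p r.
Proof. by move=> h1 h2 n nN; rewrite h1 ?h2. Qed.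

Lemma eqND p p' q q' : eqN p p' -> eqN q q' -> eqN (p + q) (p' + q').
Proof. by move=> h1 h2 n nN; rewrite !coefD h1 ?h2. Qed.

Lemma eqNM p p' q q' : eqN p p' -> eqN q q' -> eqN (p * q) (p' * q').
Proof.
move=> h1 h2 n nN; rewrite !coefM; apply: eq_bigr => i _.
by rewrite h1 ?h2 //; apply: leq_ltn_trans nN; rewrite ?leq_subr // -ltnS.
Qed.

Lemma eqNZ a p q : eqN p q -> eqN (a *: p) (a *: q).
Proof. by move=> h n nN; rewrite !coefZ h. Qed.

Lemma eqN_sum (I : finType) (f g : I -> {poly K}) :
  (forall i, eqN (f i) (g i)) -> eqN (\sum_i f i) (\sum_i g i).
Proof. by move=> h n nN; rewrite !coef_sum; apply: eq_bigr => i _; apply: h. Qed.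

Lemma eqN_take p : eqN p (\sum_(i < N) p`_i *: 'X^i).
Proof.
move=> n nN; rewrite coef_sum (bigD1 (Ordinal nN)) //= coefZ coefXn eqxx mulr1.
rewrite big1 ?addr0 // => i; rewrite -val_eqE /= => ni.
by rewrite coefZ coefXn eq_sym (negPf ni) mulr0.
Qed.

(* The series (1 + a z)^s in z = 1 / xi. *)
Definition bseries s a : {poly K} := \poly_(j < N) (iota (gbinom s j) * a ^+ j).

Lemma coef_bseries s a n :
  (n < N)%N -> (bseries s a)`_n = iota (gbinom s n) * a ^+ n.
Proof. by move=> nN; rewrite coef_poly nN. Qed.

Lemma bseries0 a : eqN (bseries 0 a) 1.
Proof.
move=> [|n] nN; rewrite coef_bseries // coef1.
  by rewrite gbinom0 rmorph1 mul1r.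
by rewrite gbinom0S rmorph0 mul0r.
Qed.

Lemma bseries1 a : eqN (bseries 1 a) (1 + a *: 'X).
Proof.
move=> [|[|n]] nN; rewrite coef_bseries // coefD coef1 coefZ coefX.
- by rewrite gbinom0 rmorph1 mul1r mulr0 addr0.
- by rewrite gbinom1 rmorph1 mul1r mulr1 add0r.
- by rewrite gbinom1SS rmorph0 mul0r mulr0 addr0.
Qed.

Lemma bseriesM s t a : eqN (bseries s a * bseries t a) (bseries (s + t) a).
Proof.
move=> n nN; rewrite coef_bseries // coefM -gbinom_Vandermonde rmorph_sum /=.
rewrite mulr_suml; apply: eq_bigr => i _.
have le_in : (i <= n)%N by rewrite -ltnS.
rewrite !coef_bseries ?(leq_ltn_trans _ nN) ?leq_subr //.
have -> : a ^+ n = a ^+ i * a ^+ (n - i) by rewrite -exprD subnKC.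
by rewrite rmorphM; ring.
Qed.

(* If p(z) xi^d is a symbol with constant coefficients, its translate by a
   (xi replaced by xi + a) is (shift d a p)(z) xi^d. *)
Definition shift d a p : {poly K} :=
  \sum_(i < N) p`_i *: ('X^i * bseries (d - i%:R) a).

Lemma shift_eqN d a p q : eqN p q -> shift d a p = shift d a q.
Proof. by move=> h; apply: eq_bigr => i _; rewrite h. Qed.

Lemma shiftD d a p q : shift d a (p + q) = shift d a p + shift d a q.
Proof. by rewrite -big_split; apply: eq_bigr => i _; rewrite coefD scalerDl. Qed.

Lemma shiftZ d a b p : shift d a (b *: p) = b *: shift d a p.
Proof. by rewrite scaler_sumr; apply: eq_bigr => i _; rewrite coefZ scalerA. Qed.

Lemma shift0 d a : shift d a 0 = 0.
Proof. by rewrite -[0 in LHS](scale0r 0) shiftZ scale0r. Qed.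

Lemma shiftB d a p q : shift d a (p - q) = shift d a p - shift d a q.
Proof. by rewrite -scaleN1r shiftD shiftZ scaleN1r. Qed.

Lemma shift_sum d a (I : finType) (f : I -> {poly K}) :
  shift d a (\sum_i f i) = \sum_i shift d a (f i).
Proof. exact: (big_morph _ (shiftD d a) (shift0 d a)). Qed.

Lemma shiftXn d a m : eqN (shift d a 'X^m) ('X^m * bseries (d - m%:R) a).
Proof.
case: (ltnP m N) => mN.
  rewrite /shift (bigD1 (Ordinal mN)) //= coefXn eqxx scale1r big1 ?addr0 //.
  move=> i; rewrite -val_eqE /= => ni.
  by rewrite coefXn (negPf ni) scale0r.
have -> : shift d a 'X^m = 0.
  apply: big1 => i _; rewrite coefXn ltn_eqF ?scale0r //.
  exact: leq_trans (ltn_ord i) mN.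
by move=> n nN; rewrite coef0 coefXnM (leq_trans nN mN).
Qed.

Lemma shift1 d a : eqN (shift d a 1) (bseries d a).
Proof. by have := shiftXn d a 0; rewrite expr0 mul1r subr0. Qed.

(** On monomials this is (xi + a)^(d - i) (xi + a)^(e - j) = (xi + a)^(d + e - i - j), that is,
    [bseriesM]. Translation of xi is thus multiplicative once leading exponents are added. *)
Lemma shift_mul d e a p q :
  eqN (shift d a p * shift e a q) (shift (d + e) a (p * q)).
Proof.
rewrite (shift_eqN _ _ (eqNM (eqN_take p) (eqN_take q))).
rewrite [in X in eqN X _]/shift !mulr_suml shift_sum.
apply: eqN_sum => i; rewrite !mulr_sumr shift_sum; apply: eqN_sum => j.
rewrite -!scalerAl -!scalerAr !scalerA -exprD shiftZ; apply: eqNZ.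
apply: eqN_sym; apply: eqN_trans (shiftXn _ _ _) _.
rewrite exprD -!mulrA; apply: eqNM => //.
rewrite mulrCA; apply: eqNM => //; apply: eqN_sym.
have -> : d + e - (i + j)%:R = (d - i%:R) + (e - j%:R) by rewrite natrD; ring.
exact: bseriesM.
Qed.

Lemma shift_bseries s a b :
  eqN (shift s a (bseries s b)) (bseries s (a + b)).
Proof.
move=> n nN; rewrite coef_bseries // exprDn mulr_sumr /shift coef_sum.
rewrite (big_ord_widen N (fun i => iota (gbinom s n) *
  (a ^+ (n - i) * b ^+ i *+ 'C(n, i)))) // [RHS]big_mkcond /=.
apply: eq_bigr => i _; rewrite coefZ coefXnM ltnS.
case: (ltnP n i) => in_; first by rewrite mulr0.
rewrite !coef_bseries ?(leq_ltn_trans (leq_subr _ _)) //.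
have := gbinom_trinomial s i (n - i); rewrite subnKC // => tri.
transitivity (iota (gbinom s i * gbinom (s - i%:R) (n - i))
                * (a ^+ (n - i) * b ^+ i)); first by rewrite rmorphM; ring.
by rewrite tri rmorphM rmorph_nat -mulr_natr; ring.
Qed.

Lemma shift_shift d a b p :
  eqN (shift d a (shift d b p)) (shift d (a + b) p).
Proof.
rewrite {2}/shift shift_sum; apply: eqN_sum => i; rewrite shiftZ.
apply: eqNZ.
(* The term is read as (X^i xi^i) (xi + b)^(d - i): the first factor is the constant 1, fixed by
   translation, and [shift_bseries] translates the second. *)
have -> : d = i%:R + (d - i%:R) by ring.
apply: eqN_trans (eqN_sym (shift_mul _ _ _ _ _)) _.
have -> : i%:R + (d - i%:R) - i%:R = d - i%:R by ring.
apply: eqNM; last exact: shift_bseries.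
apply: eqN_trans (shiftXn _ _ _) _; rewrite subrr -[X in eqN _ X]mulr1.
by apply: eqNM => //; apply: bseries0.
Qed.

(** As X xi = 1 is fixed by translation, a factor ['X] passes through when the leading exponent is
    raised by one. *)
Lemma shift_polyX d a p : eqN (shift (d + 1) a ('X * p)) ('X * shift d a p).
Proof.
rewrite addrC; apply: eqN_trans (eqN_sym (shift_mul _ _ _ _ _)) _.
apply: eqNM => //; apply: eqN_trans (shiftXn _ _ 1) _; rewrite subrr.
by rewrite -[X in eqN _ X]mulr1; apply: eqNM => //; apply: bseries0.
Qed.

(** * The bracket relation for the three-parameter family *)

Section Family.
Variables mu lam alpha : F.

(* With z = 1 / xi, xi * base_symbol a is (xi + a)^mu (xi + lam a) xi^(-mu). *)
Definition base_symbol a : {poly K} :=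
  bseries mu a * (1 + (iota lam * a) *: 'X).

Definition family_symbol a : {poly K} := shift 1 (iota alpha) (base_symbol a).

(** Telescoping: the two factors are ((xi + a + b)/(xi + b))^mu and ((xi + b)/xi)^mu. The second
    comes from translating xi^mu, so [shift_mul] can join them. *)
Lemma bseries_cocycle a b :
  eqN (shift 0 b (bseries mu a) * bseries mu b) (bseries mu (a + b)).
Proof.
apply: eqN_trans (eqNM (@eqN_refl _) (eqN_sym (shift1 mu b))) _.
apply: eqN_trans (shift_mul _ _ _ _ _) _; rewrite add0r mulr1 addrC.
exact: shift_bseries.
Qed.

Lemma base_symbol_comp a b :
  eqN (shift 1 b (base_symbol a) * base_symbol b)
      (bseries mu (a + b) * ((1 + (b + iota lam * a) *: 'X) *
                             (1 + (iota lam * b) *: 'X))).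
Proof.
apply: eqN_trans (_ : eqN _ ((shift 0 b (bseries mu a) * bseries mu b) *
   (shift 1 b (1 + (iota lam * a) *: 'X) * (1 + (iota lam * b) *: 'X)))) _.
  rewrite mulrACA; apply: eqNM => //; apply: eqN_sym.
  by apply: eqN_trans (shift_mul _ _ _ _ _) _; rewrite add0r.
apply: eqNM; first exact: bseries_cocycle.
apply: eqNM => //; rewrite shiftD shiftZ scalerDl addrA.
apply: eqND; first by apply: eqN_trans (shift1 _ _) (bseries1 _).
apply: eqNZ; rewrite -[X in eqN _ X]mulr1.
apply: eqN_trans (shiftXn _ _ 1) _; rewrite subrr.
by apply: eqNM => //; apply: bseries0.
Qed.

(** Both products share the factor [bseries mu (a + b)], symmetric in [a] and [b]; what is left is
    the case mu = 0, an identity between quadratic polynomials in X. *)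
Lemma base_symbol_bracket a b :
  eqN (shift 1 b (base_symbol a) * base_symbol b -
       shift 1 a (base_symbol b) * base_symbol a)
      ((b - a) *: ('X * base_symbol (a + b))).
Proof.
have h := base_symbol_comp b a; rewrite [b + a]addrC in h.
move: h => /(eqNZ (-1)); rewrite !scaleN1r => h.
apply: eqN_trans (eqND (base_symbol_comp a b) h) _.
suff -> : (b - a) *: ('X * base_symbol (a + b)) =
  bseries mu (a + b) * ((1 + (b + iota lam * a) *: 'X) *
                        (1 + (iota lam * b) *: 'X)) -
  bseries mu (a + b) * ((1 + (a + iota lam * b) *: 'X) *
                        (1 + (iota lam * a) *: 'X)) by [].
rewrite /base_symbol -!mul_polyC !polyCD !polyCN !polyCM.
by ring.
Qed.

(** Translation by alpha commutes with the other translations and respects products, so it carries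
    [base_symbol_bracket] over. The exponent [1 + 1] is the order of a product of two symbols of
    order one. *)
Lemma family_symbol_bracket a b :
  eqN (shift 1 b (family_symbol a) * family_symbol b -
       shift 1 a (family_symbol b) * family_symbol a)
      ((b - a) *: ('X * family_symbol (a + b))).
Proof.
have comp x y : eqN (shift 1 y (family_symbol x) * family_symbol y)
    (shift (1 + 1) (iota alpha) (shift 1 y (base_symbol x) * base_symbol y)).
  apply: eqN_sym; apply: eqN_trans (eqN_sym (shift_mul _ _ _ _ _)) _.
  apply: eqNM => //; apply: eqN_trans (shift_shift _ _ _ _) _.
  by rewrite addrC; apply: eqN_sym; apply: shift_shift.
have h := comp b a; move: h => /(eqNZ (-1)); rewrite !scaleN1r => h.
apply: eqN_trans (eqND (comp a b) h) _; rewrite -shiftB.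
rewrite (shift_eqN _ _ (base_symbol_bracket a b)) shiftZ.
by apply: eqNZ; apply: shift_polyX.
Qed.

End Family.

End TruncatedSeries.

(** In the composition formula [k] counts xi-derivatives and [i] is the index of the left
    coefficient; only m = k + i determines the index of the right one, hence this regrouping. *)
Lemma big_triangle (V : nmodType) (G : nat -> nat -> V) n :
  \sum_(k < n.+1) \sum_(i < (n - k).+1) G k i =
  \sum_(m < n.+1) \sum_(i < m.+1) G (m - i)%N i.
Proof.
elim: n => [|n IHn]; first by rewrite !big_ord1.
have diag : \sum_(i < n.+2) G (n.+1 - i)%N i =
    \sum_(k < n.+1) G k (n.+1 - k)%N + G n.+1 0%N.
  rewrite (reindex_inj rev_ord_inj) big_ord_recr /= subnn subn0; congr (_ + _).
  by apply: eq_bigr => k _; rewrite subSS subKn // leqW // -ltnS.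
rewrite [RHS]big_ord_recr -IHn /= diag addrA -big_split big_ord_recr.
congr (_ + _); last by rewrite /= subnn big_ord1.
apply: eq_bigr => k _ /=; have kn : (k <= n)%N by rewrite -ltnS.
by rewrite subSn // big_ord_recr.
Qed.

(** * The bracket relation order by order in xi *)

Section SymbolicBracket.
Variables (F : numFieldType) (K : comNzRingType) (iota : {rmorphism F -> K}).
Implicit Types (Phi : nat -> {poly F}) (a b : K).

Definition evalp (u : {poly F}) a : K := (map_poly iota u).[a].

(* The coefficient of xi^(2-n) in Phi(a, xi + b) Phi(b, xi), where
   Phi(p, xi) = \sum_i Phi_i(p) xi^(1-i). *)
Definition symbol_comp Phi n a b : K :=
  \sum_(m < n.+1) \sum_(i < m.+1) iota (gbinom (1 - i%:R) (m - i)) *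
     (evalp (Phi i) a * (b ^+ (m - i) * evalp (Phi (n - m)%N) b)).

(* The coefficient of xi^(2-n) in (b - a) Phi(a + b, xi). *)
Definition symbol_target Phi n a b : K :=
  if n is m.+1 then (b - a) * evalp (Phi m) (a + b) else 0.

Definition symbol_hom Phi a b := forall n,
  symbol_comp Phi n a b - symbol_comp Phi n b a = symbol_target Phi n a b.

Lemma coef_shift N d a (p : {poly K}) n : (n < N)%N ->
  (shift iota N d a p)`_n =
  \sum_(i < n.+1) iota (gbinom (d - i%:R) (n - i)) * a ^+ (n - i) * p`_i.
Proof.
move=> nN; rewrite /shift coef_sum.
rewrite (big_ord_widen N (fun i => iota (gbinom (d - i%:R) (n - i)) *
  a ^+ (n - i) * p`_i)) // [RHS]big_mkcond /=.
apply: eq_bigr => i _; rewrite coefZ coefXnM ltnS.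
case: (ltnP n i) => in_; first by rewrite mulr0.
by rewrite coef_bseries ?(leq_ltn_trans (leq_subr _ _)) // mulrC.
Qed.

Section FamilyCoefficients.
Variables mu lam alpha : F.

Definition base_coef k : F :=
  gbinom mu k + lam * (if k is j.+1 then gbinom mu j else 0).

(** Each term base_coef k p^k xi^(1-k) of the untranslated symbol is expanded through (xi +
    alpha)^(1-k), and its part in xi^(1-n) is kept. *)
Definition deformation_symbol n : {poly F} :=
  \poly_(k < n.+1)
    (gbinom (1 - k%:R) (n - k) * alpha ^+ (n - k) * base_coef k).

Lemma coef_base_symbol N k a : (k < N)%N ->
  (base_symbol iota N mu lam a)`_k = iota (base_coef k) * a ^+ k.
Proof.
move=> kN; rewrite /base_symbol mulrDr mulr1 coefD -scalerAr coefZ coefMX coef_bseries //.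
case: k kN => [|k] kN /=.
  by rewrite /base_coef !mulr0 !addr0.
rewrite coef_bseries; last exact: ltnW.
by rewrite /base_coef rmorphD rmorphM exprS; ring.
Qed.

Lemma coef_family_symbol N n a : (n < N)%N ->
  (family_symbol iota N mu lam alpha a)`_n = evalp (deformation_symbol n) a.
Proof.
move=> nN; rewrite coef_shift // /evalp.
rewrite (@horner_coef_wide _ n.+1); last first.
  by rewrite (leq_trans (size_poly _ _)) // size_poly.
apply: eq_bigr => k _.
rewrite coef_base_symbol; last exact: leq_trans (ltn_ord k) nN.
by rewrite coef_map coef_poly ltn_ord -rmorphXn mulrA -!rmorphM.
Qed.

Lemma deformation_symbol_hom a b : symbol_hom deformation_symbol a b.
Proof.
(* Only coefficients of index at most n enter this order, so the truncation is chosen as [n.+1],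
   separately for each n. *)
have comp n x y : symbol_comp deformation_symbol n x y =
    (shift iota n.+1 1 y (family_symbol iota n.+1 mu lam alpha x) *
     family_symbol iota n.+1 mu lam alpha y)`_n.
  rewrite coefM; apply: eq_bigr => m _.
  rewrite coef_shift // mulr_suml; apply: eq_bigr => i _.
  rewrite !coef_family_symbol ?ltnS ?leq_subr //; last first.
    exact: leq_trans (ltn_ord i) (ltn_ord m).
  by ring.
move=> n; rewrite !comp -coefB family_symbol_bracket //.
rewrite coefZ coefXM; case: n => [|n] /=; first by rewrite mulr0.
by rewrite coef_family_symbol // ltnW.
Qed.

End FamilyCoefficients.

End SymbolicBracket.

(** * Extraction of the coefficients of p^s q^r *)

Section BivariateSymbols.
Variable F : numFieldType.
Implicit Types (u v : {poly F}) (Phi : nat -> {poly F}).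

(** In [{poly {poly F}}] the inner variable ['X%:P] plays p and the outer variable ['X] plays q; a
    double coefficient therefore extracts the exponent of q first. *)
Definition constPP : {rmorphism F -> {poly {poly F}}} := polyC \o polyC.

Lemma evalpX u : evalp constPP u 'X%:P = u%:P.
Proof.
rewrite /evalp map_poly_comp horner_map /=; congr _%:P.
exact: comp_polyXr.
Qed.

Lemma evalpY u : evalp constPP u 'X = map_poly polyC u.
Proof. by rewrite /evalp map_poly_comp; exact: comp_polyXr. Qed.

Lemma coef_evalpXY u r s :
  (evalp constPP u ('X%:P + 'X))`_r`_s = u`_(s + r) *+ 'C(s + r, s).
Proof.
have pow j : (('X%:P + 'X : {poly {poly F}}) ^+ j)`_r`_s =
    (j == s + r)%N%:R *+ 'C(s + r, s).
  rewrite exprDn coef_sum coef_sum.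
  under eq_bigr => i _ do
    rewrite -polyC_exp coefMn coefCM coefXn coefMn mulr_natr coefMn coefXn.
  case: (ltnP j r) => jr.
    rewrite ltn_eqF ?mul0rn; last exact: leq_trans jr (leq_addl _ _).
    apply: big1 => i _; rewrite [r == _]gtn_eqF ?mulr0n ?mul0rn //.
    by rewrite (leq_ltn_trans _ jr) // -ltnS.
  have rj : (r < j.+1)%N by [].
  rewrite (bigD1 (Ordinal rj)) //= eqxx mulr1n big1 ?addr0; last first.
    by move=> i; rewrite -val_eqE /= eq_sym => /negPf ->; rewrite mulr0n mul0rn.
  have -> : (s == j - r)%N = (j == s + r)%N.
    by apply/eqP/eqP => [->|->]; rewrite ?subnK ?addnK.
  by case: eqP => [->|]; rewrite ?mul0rn // -bin_sub ?leq_addl // addnK.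
rewrite /evalp (@horner_coef_wide _ (maxn (size u) (s + r).+1)); last first.
  by rewrite (leq_trans (size_poly _ _)) // leq_maxl.
have srk : (s + r < maxn (size u) (s + r).+1)%N by rewrite leq_maxr.
rewrite 2!coef_sum (bigD1 (Ordinal srk)) //= big1 ?addr0.
  by rewrite coef_map /= !coefCM pow eqxx mulrnAr mulr1.
move=> j; rewrite -val_eqE /= => /negPf nj.
by rewrite coef_map /= !coefCM pow nj mul0rn mulr0.
Qed.

Definition comp_coef Phi n s r : F :=
  \sum_(m < n.+1) \sum_(i < m.+1) gbinom (1 - i%:R) (m - i) *
     ((Phi i)`_s * ('X^(m - i) * Phi (n - m)%N)`_r).

Lemma coef_symbol_compXY Phi n s r :
  (symbol_comp constPP Phi n 'X%:P 'X)`_r`_s = comp_coef Phi n s r.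
Proof.
rewrite 2!coef_sum; apply: eq_bigr => m _; rewrite 2!coef_sum.
apply: eq_bigr => i _; rewrite evalpX evalpY !coefCM; congr (_ * _).
by rewrite -(map_polyXn polyC) -rmorphM coef_map /= coefMC.
Qed.

Lemma coef_symbol_compYX Phi n s r :
  (symbol_comp constPP Phi n 'X 'X%:P)`_r`_s = comp_coef Phi n r s.
Proof.
rewrite 2!coef_sum; apply: eq_bigr => m _; rewrite 2!coef_sum.
apply: eq_bigr => i _; rewrite evalpX evalpY !coefCM; congr (_ * _).
by rewrite -polyC_exp -polyCM coefMC coef_map /= coefCM.
Qed.

Lemma symbol_hom_coef Phi n s r : symbol_hom constPP Phi 'X%:P 'X ->
  comp_coef Phi n.+1 s.+1 r.+1 - comp_coef Phi n.+1 r.+1 s.+1 =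
  (Phi n)`_(s + r).+1 *+ 'C((s + r).+1, s.+1) -
  (Phi n)`_(s + r).+1 *+ 'C((s + r).+1, s).
Proof.
move=> /(_ n.+1) /(congr1 (fun b : {poly {poly F}} => b`_r.+1`_s.+1)).
rewrite /= !coefB coef_symbol_compXY coef_symbol_compYX => ->.
by rewrite mulrBl !coefB coefXM coefCM coefXM /= !coef_evalpXY addSn addnS.
Qed.

Section NormalizedSymbols.
Variable Phi : nat -> {poly F}.
Hypothesis Phi_hom : symbol_hom constPP Phi 'X%:P 'X.
Hypothesis Phi0 : Phi 0 = 1.
Hypothesis size_Phi1 : (size (Phi 1) <= 2)%N.

(* The p q^d coefficient of the bracket relation reads (m - d) [p^d]Phi_m = 0. *)
Lemma symbol_degree m d : (m < d)%N -> (Phi m)`_d = 0.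
Proof.
elim/ltn_ind: m d => M IHm d md.
have [M0|[M1|M2]] : M = 0 \/ M = 1 \/ (1 < M)%N by lia.
- by rewrite {M}M0 in md IHm *; rewrite Phi0 coef1 gtn_eqF.
- rewrite {M}M1 in md IHm *; exact: nth_default (leq_trans size_Phi1 md).
(* Only m = i = 1 contributes: [Phi 0] contains no p, and for larger m the right factor has index
   below M, where the induction bounds its degree. *)
have left : comp_coef Phi M.+1 1 d = (Phi 1)`_1 * (Phi M)`_d.
  have M1 : (1 < M.+2)%N by [].
  rewrite /comp_coef (bigD1 (Ordinal M1)) //= [X in _ + X]big1 ?addr0 => [|k].
    rewrite big_ord_recr big_ord1 /= !subSS !subn0 gbinom0 expr0 !mul1r.
    by rewrite Phi0 coef1 mul0r mulr0 add0r.
  rewrite -val_eqE /= => k1; apply: big1 => i _.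
  have [i0|i_gt0] := posnP i; first by rewrite i0 Phi0 coef1 mul0r mulr0.
  rewrite coefXnM; case: ifP => _; first by rewrite !mulr0.
  rewrite [X in _ * (_ * X)]IHm ?mulr0 //.
    have := ltn_ord i; lia.
  have := ltn_ord i; have := ltn_ord k; rewrite /=; lia.
(* The induction kills [i < M]. The pairs (m, i) left are (M, M), (M+1, M) and (M+1, M+1), and the
   last one vanishes because [Phi 0] has no linear term. *)
have right : comp_coef Phi M.+1 d 1 =
    (Phi 1)`_1 * (Phi M)`_d + (1 - M%:R) * (Phi M)`_d.
  rewrite /comp_coef big_ord_recr big_ord_recr /=.
  rewrite big1; last first.
    move=> k _; apply: big1 => i _.
    have iM : (i < M)%N := leq_trans (ltn_ord i) (ltn_ord k).
    by rewrite IHm ?mul0r ?mulr0 // (ltn_trans iM).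
  rewrite add0r (big_ord_recr M.+1) !(big_ord_recr M) /=.
  rewrite !subnn !subSnn big1; last first.
    by move=> i _; rewrite IHm ?mul0r ?mulr0 // (ltn_trans (ltn_ord i)).
  rewrite big1; last first.
    by move=> i _; rewrite IHm ?mul0r ?mulr0 // (ltn_trans (ltn_ord i)).
  rewrite !gbinom0 gbinom1 Phi0 !expr0 !expr1 !mul1r mulr1 coefX coef1 /=.
  by rewrite !add0r !mulr0 addr0 mulr1 mulrC.
case: d => [//|d] in md left right *.
have := symbol_hom_coef M 0 d Phi_hom; rewrite left right !add0n bin0 bin1.
have nz : M%:R - d.+1%:R != 0 :> F.
  by rewrite subr_eq0 eqr_nat ltn_eqF.
rewrite mulr1n -mulr_natr => h; apply: (mulfI nz); rewrite mulr0.
move/eqP: h; rewrite -subr_eq0 => /eqP {2}<-; ring.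
Qed.

Definition top_coef k := (Phi k)`_k.

Definition top_comp s r : F :=
  top_coef s * \sum_(j < r.+1) gbinom (1 - s%:R) j * top_coef (r - j).

(** Total degree s + r is the largest that [symbol_degree] allows at this order, so each factor
    contributes its top coefficient and [i] must equal [s]. The top coefficients thus satisfy a
    closed system, free of c0. *)
Lemma comp_coef_top s r : comp_coef Phi (s + r) s r = top_comp s r.
Proof.
rewrite /comp_coef /top_comp -addnS big_split_ord /= big1 ?add0r; last first.
  move=> k _; apply: big1 => i _; rewrite symbol_degree ?mul0r ?mulr0 //.
  by rewrite (leq_trans (ltn_ord i)).
rewrite mulr_sumr; apply: eq_bigr => j _.
have si : (s < (s + j).+1)%N by rewrite ltnS leq_addr.
rewrite (bigD1 (Ordinal si)) //= big1 ?addr0; last first.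
  move=> i; rewrite -val_eqE /= neq_ltn => /orP [lt_is|gt_is].
    by rewrite symbol_degree ?mul0r ?mulr0.
  rewrite coefXnM; case: ifP => // jr; first by rewrite !mulr0.
  rewrite [X in _ * (_ * X)]symbol_degree ?mulr0 //.
  have := ltn_ord i; have := ltn_ord j; rewrite /=; lia.
rewrite addKn coefXnM ltnNge -ltnS ltn_ord /= subnDl /top_coef.
by ring.
Qed.

Lemma top_coef_bracket s r :
  top_comp s.+1 r.+1 - top_comp r.+1 s.+1 =
  top_coef (s + r).+1 *+ 'C((s + r).+1, s.+1) -
  top_coef (s + r).+1 *+ 'C((s + r).+1, s).
Proof.
rewrite -symbol_hom_coef // -comp_coef_top -[X in _ - X = _]comp_coef_top.
by rewrite [in X in _ - X = _]addnC !addSn !addnS.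
Qed.

End NormalizedSymbols.
End BivariateSymbols.

(** * The polynomial of the theorem: elimination in both directions *)

Definition deformation_poly (R : comNzRingType) (c1 c2 c3 : R) : R :=
  6 * c1 ^+ 3 * c3 - 3 * c1 ^+ 2 * c2 ^+ 2 - 18 * c1 * c2 * c3
    + 8 * c2 ^+ 3 + 9 * c3 ^+ 2 + 3 * c1 ^+ 3 * c2 - 6 * c1 * c2 ^+ 2
    - 9 * c1 ^+ 2 * c3 + 18 * c2 * c3 + 3 * c1 * c3
    - 5 * c1 ^+ 2 * c2 + 8 * c2 ^+ 2 + 2 * c1 * c2.

Section DeformationPoly.
Variable F : numFieldType.
Implicit Types (x mu lam c : F).

Lemma gbinom2 x : gbinom x 2 = x * (x - 1) / 2.
Proof. by rewrite /gbinom !big_ord_recl big_ord0 subr0 mulr1. Qed.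

Lemma gbinom3 x : gbinom x 3 = x * (x - 1) * (x - 2) / 6.
Proof. by rewrite /gbinom !big_ord_recl big_ord0 subr0 mulr1 mulrA. Qed.

(** Upper negation, as [1 - s.+2] is -(s + 1). It turns the coefficients of [top_comp] into
    binomials of natural numbers, which compute. *)
Lemma gbinom_neg s j :
  gbinom (1 - s.+2%:R) j = (-1) ^+ j * 'C(s + j, j)%:R :> F.
Proof.
elim: j => [|j IHj]; first by rewrite gbinom0 bin0 mulr1.
have j1 : j.+1%:R != 0 :> F by rewrite pnatr_eq0.
apply: (mulfI j1); rewrite gbinomS IHj [RHS]mulrCA -natrM.
by rewrite addnS -mul_bin_diag /= natrM exprS !mulrSr natrD; ring.
Qed.

(** The relations at p q^r and p^r q^r are vacuous, so b_1, b_2, b_3 start out free and p^2 q^(k-1)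
    determines b_k for k = 4, 5, 6. Total degree 7 is the first with a second relation, at p^3 q^4:
    it gives b_6 again, hence a constraint. *)
Lemma deformation_poly_necessary (Phi : nat -> {poly F}) :
  symbol_hom (constPP F) Phi 'X%:P 'X -> Phi 0 = 1 -> (size (Phi 1) <= 2)%N ->
  deformation_poly (Phi 1)`_1 (Phi 2)`_2 (Phi 3)`_3 = 0.
Proof.
move=> hom Phi0 size1.
have top s r := top_coef_bracket hom Phi0 size1 s r.
rewrite -!/(top_coef Phi _).
have b0 : top_coef Phi 0 = 1 by rewrite /top_coef Phi0 coef1.
move: top; rewrite /top_comp.
move: (top_coef Phi) b0 {hom Phi0 size1} => b b0 top.
have h4 : b 2 * (b 3 - b 2 + b 1 - 1) -
    b 3 * (b 2 - 2 * b 1 + 3) = 2 * b 4.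
  apply: (etrans _ (etrans (top 1 2) _)).
    rewrite !big_ord_recl !big_ord0 !gbinom_neg.
    (* Conversion evaluates the indices and the binomial coefficients to numerals, which leaves a
       goal for [ring]. *)
    rewrite -[RHS]/(b 2 * ((-1) ^+ 0 * 1%:R * b 3%N + ((-1) ^+ 1 * 1%:R * b 2%N
      + ((-1) ^+ 2 * 1%:R * b 1%N + ((-1) ^+ 3 * 1%:R * b 0%N + 0)))) - b 3 *
      ((-1) ^+ 0 * 1%:R * b 2%N + ((-1) ^+ 1 * 2%:R * b 1%N + ((-1) ^+ 2 * 3%:R
      * b 0%N + 0)))).
    by rewrite b0; ring.
  by change (b 4 *+ 6 - b 4 *+ 4 = 2 * b 4); ring.
have h5 : b 2 * (b 4 - b 3 + b 2 - b 1 + 1) -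
    b 4 * (b 2 - 3 * b 1 + 6) = 5 * b 5.
  apply: (etrans _ (etrans (top 1 3) _)).
    rewrite !big_ord_recl !big_ord0 !gbinom_neg.
    rewrite -[RHS]/(b 2 * ((-1) ^+ 0 * 1%:R * b 4%N + ((-1) ^+ 1 * 1%:R * b 3%N
      + ((-1) ^+ 2 * 1%:R * b 2%N + ((-1) ^+ 3 * 1%:R * b 1%N + ((-1) ^+ 4 *
      1%:R * b 0%N + 0))))) - b 4 * ((-1) ^+ 0 * 1%:R * b 2%N + ((-1) ^+ 1 *
      3%:R * b 1%N + ((-1) ^+ 2 * 6%:R * b 0%N + 0)))).
    by rewrite b0; ring.
  by change (b 5 *+ 10 - b 5 *+ 5 = 5 * b 5); ring.
have h6 : b 2 * (b 5 - b 4 + b 3 - b 2 + b 1 - 1) -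
    b 5 * (b 2 - 4 * b 1 + 10) = 9 * b 6.
  apply: (etrans _ (etrans (top 1 4) _)).
    rewrite !big_ord_recl !big_ord0 !gbinom_neg.
    rewrite -[RHS]/(b 2 * ((-1) ^+ 0 * 1%:R * b 5%N + ((-1) ^+ 1 * 1%:R * b 4%N
      + ((-1) ^+ 2 * 1%:R * b 3%N + ((-1) ^+ 3 * 1%:R * b 2%N + ((-1) ^+ 4 *
      1%:R * b 1%N + ((-1) ^+ 5 * 1%:R * b 0%N + 0)))))) - b 5 * ((-1) ^+ 0 *
      1%:R * b 2%N + ((-1) ^+ 1 * 4%:R * b 1%N + ((-1) ^+ 2 * 10%:R * b 0%N +
      0)))).
    by rewrite b0; ring.
  by change (b 6 *+ 15 - b 6 *+ 6 = 9 * b 6); ring.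
have h7 : b 3 * (b 4 - 2 * b 3 + 3 * b 2 - 4 * b 1 + 5) -
    b 4 * (b 3 - 3 * b 2 + 6 * b 1 - 10) = 5 * b 6.
  apply: (etrans _ (etrans (top 2 3) _)).
    rewrite !big_ord_recl !big_ord0 !gbinom_neg.
    rewrite -[RHS]/(b 3 * ((-1) ^+ 0 * 1%:R * b 4%N + ((-1) ^+ 1 * 2%:R * b 3%N
      + ((-1) ^+ 2 * 3%:R * b 2%N + ((-1) ^+ 3 * 4%:R * b 1%N + ((-1) ^+ 4 *
      5%:R * b 0%N + 0))))) - b 4 * ((-1) ^+ 0 * 1%:R * b 3%N + ((-1) ^+ 1 *
      3%:R * b 2%N + ((-1) ^+ 2 * 6%:R * b 1%N + ((-1) ^+ 3 * 10%:R * b 0%N +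
      0))))).
    by rewrite b0; ring.
  by change (b 6 *+ 20 - b 6 *+ 15 = 5 * b 6); ring.
have b4 : b 4 = (b 2 * (b 3 - b 2 + b 1 - 1) - b 3 * (b 2 - 2 * b 1 + 3)) / 2.
  by rewrite h4; field.
have b5 : b 5 = (b 2 * (b 4 - b 3 + b 2 - b 1 + 1) -
    b 4 * (b 2 - 3 * b 1 + 6)) / 5 by rewrite h5; field.
have b6 : b 6 = (b 2 * (b 5 - b 4 + b 3 - b 2 + b 1 - 1) -
    b 5 * (b 2 - 4 * b 1 + 10)) / 9 by rewrite h6; field.
move/eqP: h7; rewrite -subr_eq0 b6 b5 b4 => /eqP h7.
(* Once b_4, b_5 and b_6 are substituted, the difference of the two sides at p^3 q^4 is exactly -2/9
   times the polynomial. *)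
apply: (mulfI (_ : - 2 / 9 != 0 :> F)).
  by rewrite mulf_neq0 ?invr_eq0 ?oppr_eq0 ?pnatr_eq0.
by rewrite mulr0 -[RHS]h7 /deformation_poly; field.
Qed.

(* With lam = c1 - mu the second equation of the family is quadratic in mu, with
   roots mu1 and mu2; the product below is its resultant with the third one. *)
Lemma deformation_poly_resultant c1 c2 c3 mu1 mu2 :
  mu1 + mu2 = 2 * c1 - 1 -> mu1 * mu2 = 2 * c2 ->
  (gbinom mu1 3 + (c1 - mu1) * gbinom mu1 2 - c3) *
  (gbinom mu2 3 + (c1 - mu2) * gbinom mu2 2 - c3) =
  deformation_poly c1 c2 c3 / 9.
Proof.
rewrite !gbinom2 !gbinom3 => hs hp.
have -> : c2 = mu1 * mu2 / 2 by rewrite hp; field.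
have -> : c1 = (mu1 + mu2 + 1) / 2 by rewrite hs; field.
by rewrite /deformation_poly; field.
Qed.

End DeformationPoly.

(** * From polynomials in p and q to jets of functions *)

Section JetPairing.
Variable F : numFieldType.
Implicit Types (u v : {poly F}) (b : {poly {poly F}}) (J : nat -> F).

(* A polynomial in the symbol p of d/dx is evaluated on a jet J by p^j |-> J j;
   a bivariate polynomial is evaluated on a pair of jets. *)
Definition jet_eval J u : F := \sum_(j < size u) u`_j * J j.

Definition jet_pair J J' b : F := \sum_(r < size b) jet_eval J b`_r * J' r.

Lemma jet_eval_wide N J u : (size u <= N)%N ->
  jet_eval J u = \sum_(j < N) u`_j * J j.
Proof.
move=> uN; rewrite /jet_eval (big_ord_widen N (fun j => u`_j * J j)) //.
rewrite big_mkcond; apply: eq_bigr => j _; case: ltnP => // uj.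
by rewrite nth_default // mul0r.
Qed.

Lemma jet_eval0 J : jet_eval J 0 = 0.
Proof. by rewrite /jet_eval size_poly0 big_ord0. Qed.

Lemma jet_evalD J u v : jet_eval J (u + v) = jet_eval J u + jet_eval J v.
Proof.
have [uN vN] := (leq_maxl (size u) (size v), leq_maxr (size u) (size v)).
rewrite (jet_eval_wide J uN) (jet_eval_wide J vN) -big_split.
rewrite (jet_eval_wide J (size_polyD u v)).
by apply: eq_bigr => j _; rewrite coefD mulrDl.
Qed.

Lemma jet_evalZ J c u : jet_eval J (c *: u) = c * jet_eval J u.
Proof.
rewrite (jet_eval_wide J (size_scale_leq c u)) mulr_sumr.
by apply: eq_bigr => j _; rewrite coefZ mulrA.
Qed.

Lemma jet_evalXn J j : jet_eval J 'X^j = J j.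
Proof.
rewrite /jet_eval size_polyXn big_ord_recr /= coefXn eqxx mul1r.
by rewrite big1 ?add0r // => i _; rewrite coefXn ltn_eqF // mul0r.
Qed.

Lemma jet_eval_mulXn J j u :
  jet_eval J ('X^j * u) = \sum_(i < size u) u`_i * J (i + j)%N.
Proof.
rewrite -{1}(coefK u) poly_def mulr_sumr.
rewrite (big_morph _ (jet_evalD J) (jet_eval0 J)); apply: eq_bigr => i _.
by rewrite -scalerAr -exprD jet_evalZ jet_evalXn addnC.
Qed.

Lemma jet_eval_comb J1 J2 c u :
  jet_eval (fun j => J1 j + c * J2 j) u = jet_eval J1 u + c * jet_eval J2 u.
Proof.
by rewrite mulr_sumr -big_split; apply: eq_bigr => j _; rewrite mulrDr mulrCA.
Qed.

Lemma jet_eval_pow z u : jet_eval (fun j => z ^+ j) u = u.[z].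
Proof. by rewrite horner_coef. Qed.

Lemma jet_pair_wide N J J' b : (size b <= N)%N ->
  jet_pair J J' b = \sum_(r < N) jet_eval J b`_r * J' r.
Proof.
move=> bN; rewrite /jet_pair.
rewrite (big_ord_widen N (fun r => jet_eval J b`_r * J' r)) //.
rewrite big_mkcond; apply: eq_bigr => j _; case: ltnP => // bj.
by rewrite nth_default // jet_eval0 mul0r.
Qed.

Lemma jet_pair0 J J' : jet_pair J J' 0 = 0.
Proof. by rewrite /jet_pair size_poly0 big_ord0. Qed.

Lemma jet_pairD J J' b b' :
  jet_pair J J' (b + b') = jet_pair J J' b + jet_pair J J' b'.
Proof.
have [uN vN] := (leq_maxl (size b) (size b'), leq_maxr (size b) (size b')).
rewrite (jet_pair_wide J J' uN) (jet_pair_wide J J' vN) -big_split.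
rewrite (jet_pair_wide J J' (size_polyD b b')).
by apply: eq_bigr => j _; rewrite coefD jet_evalD mulrDl.
Qed.

Lemma jet_pair_sum J J' (I : finType) (B : I -> {poly {poly F}}) :
  jet_pair J J' (\sum_i B i) = \sum_i jet_pair J J' (B i).
Proof. exact: (big_morph _ (jet_pairD J J') (jet_pair0 J J')). Qed.

Lemma jet_pair_const J J' c b :
  jet_pair J J' (constPP F c * b) = c * jet_pair J J' b.
Proof.
rewrite /constPP /= mul_polyC.
rewrite (jet_pair_wide J J' (size_scale_leq c%:P b)) mulr_sumr.
by apply: eq_bigr => j _; rewrite coefZ mul_polyC jet_evalZ mulrA.
Qed.

Lemma jet_pairB J J' b b' :
  jet_pair J J' (b - b') = jet_pair J J' b - jet_pair J J' b'.
Proof.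
rewrite jet_pairD -mulN1r.
have -> : -1 = constPP F (-1) by rewrite rmorphN1.
by rewrite jet_pair_const mulN1r.
Qed.

Lemma jet_pair_prod J J' u v :
  jet_pair J J' (u%:P * map_poly polyC v) = jet_eval J u * jet_eval J' v.
Proof.
have sz : (size (u%:P * map_poly polyC v)%R <= size v)%N.
  by rewrite mul_polyC (leq_trans (size_scale_leq _ _)) // size_poly.
rewrite (jet_pair_wide J J' sz) [jet_eval J' v]/jet_eval mulr_sumr.
apply: eq_bigr => r _; rewrite coefCM coef_map /= [u * _]mulrC mul_polyC jet_evalZ.
by ring.
Qed.

Lemma jet_pair_combl J1 J2 J' c b :
  jet_pair (fun j => J1 j + c * J2 j) J' b =
  jet_pair J1 J' b + c * jet_pair J2 J' b.
Proof.
rewrite mulr_sumr -big_split; apply: eq_bigr => j _ /=.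
by rewrite jet_eval_comb mulrDl mulrA.
Qed.

Lemma jet_pair_combr J J1 J2 c b :
  jet_pair J (fun j => J1 j + c * J2 j) b =
  jet_pair J J1 b + c * jet_pair J J2 b.
Proof.
by rewrite mulr_sumr -big_split; apply: eq_bigr => j _; rewrite mulrDr mulrCA.
Qed.

Lemma jet_pair_pow z w b :
  jet_pair (fun j => z ^+ j) (fun j => w ^+ j) b = b.[w%:P].[z].
Proof.
rewrite [b.[_]]horner_coef horner_sum; apply: eq_bigr => r _.
by rewrite jet_eval_pow -polyC_exp hornerM hornerC.
Qed.

Lemma poly_eq0_multiples (c : F) u :
  c != 0 -> (forall n : nat, u.[n%:R * c] = 0) -> u = 0.
Proof.
move=> c0 uc; apply: (@roots_geq_poly_eq0 _ _
  [seq n%:R * c | n <- iota 0 (size u)]).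
- by apply/allP => _ /mapP [n _ ->]; apply/rootP.
- rewrite map_inj_uniq ?iota_uniq // => m n /(mulIf c0) /eqP.
  by rewrite eqr_nat => /eqP.
- by rewrite size_map size_iota.
Qed.

(** Root counting, once in each variable. Only multiples of one [c] are tested, because the
    exponentials on the circle have frequencies in a lattice. *)
Lemma jet_pair_eq0 (c : F) b : c != 0 ->
  (forall m n : nat, jet_pair (fun j => (m%:R * c) ^+ j)
                              (fun j => (n%:R * c) ^+ j) b = 0) -> b = 0.
Proof.
move=> c0 bmn; apply/polyP => r; rewrite coef0.
apply: (poly_eq0_multiples c0) => m.
suff : map_poly (horner_eval (m%:R * c)) b = 0.
  by move=> /(congr1 (fun q : {poly F} => q`_r)); rewrite coef_map coef0.
apply: (poly_eq0_multiples c0) => n.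
rewrite -[RHS](bmn m n) jet_pair_pow -[in LHS](hornerC (n%:R * c) (m%:R * c)).
by rewrite -/(horner_eval _ (n%:R * c)%:P) horner_map.
Qed.

Definition jet_comp (Phi : nat -> {poly F}) n J J' : F :=
  \sum_(m < n.+1) \sum_(i < m.+1) gbinom (1 - i%:R) (m - i) *
     (jet_eval J (Phi i) * jet_eval J' ('X^(m - i) * Phi (n - m)%N)).

Lemma jet_pair_compXY Phi n J J' :
  jet_pair J J' (symbol_comp (constPP F) Phi n 'X%:P 'X) = jet_comp Phi n J J'.
Proof.
rewrite jet_pair_sum; apply: eq_bigr => m _.
rewrite jet_pair_sum; apply: eq_bigr => i _.
rewrite jet_pair_const; congr (_ * _).
by rewrite evalpX evalpY -(map_polyXn polyC) -rmorphM jet_pair_prod.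
Qed.

Lemma jet_pair_compYX Phi n J J' :
  jet_pair J J' (symbol_comp (constPP F) Phi n 'X 'X%:P) = jet_comp Phi n J' J.
Proof.
rewrite jet_pair_sum; apply: eq_bigr => m _.
rewrite jet_pair_sum; apply: eq_bigr => i _.
rewrite jet_pair_const; congr (_ * _).
by rewrite evalpX evalpY -polyC_exp -polyCM mulrC jet_pair_prod mulrC.
Qed.

Definition bracket_jet J J' j : F :=
  \sum_(i < j.+1) (J i * J' (j - i).+1 - J i.+1 * J' (j - i)%N) *+ 'C(j, i).

(** Multiplication by p + q is differentiation of a product, and q - p is the bracket f g' - f' g;
    the binomial expansion of (p + q)^j becomes the Leibniz rule. *)
Lemma jet_pair_target u J J' :
  jet_pair J J' (('X - 'X%:P) * evalp (constPP F) u ('X%:P + 'X)) =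
  jet_eval (bracket_jet J J') u.
Proof.
have mono i k : jet_pair J J' ('X%:P ^+ i * 'X^k) = J i * J' k.
  by rewrite -polyC_exp -(map_polyXn polyC) jet_pair_prod !jet_evalXn.
rewrite /evalp (@horner_coef_wide _ (size u)) ?size_poly // mulr_sumr.
rewrite jet_pair_sum; apply: eq_bigr => j _; rewrite coef_map mulrCA.
rewrite jet_pair_const; congr (_ * _); rewrite addrC exprDn mulr_sumr.
rewrite jet_pair_sum (reindex_inj rev_ord_inj); apply: eq_bigr => i _ /=.
have ij : (i <= j)%N by rewrite -ltnS.
rewrite subSS subKn // bin_sub // mulrnAr -mulr_natl.
have -> : 'C(j, i)%:R = constPP F 'C(j, i)%:R by rewrite rmorph_nat.
rewrite jet_pair_const mulr_natl; congr (_ *+ _).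
rewrite -!mono -jet_pairB; congr jet_pair; rewrite !exprS; ring.
Qed.

End JetPairing.

(** * Calculus of smooth periodic functions *)

Section SmoothFunctions.
Variable R : realType.
Implicit Types (f g : R -> R) (a c x y : R).

Lemma periodic_derive1 f c : periodic f c -> periodic (derive1 f) c.
Proof.
move=> fc x; rewrite /derive1 fc.
by under eq_fun do rewrite addrA fc.
Qed.

Lemma periodic_derive1n n f c : periodic f c -> periodic (derive1n n f) c.
Proof. by move=> fc; elim: n => // n IHn; exact: periodic_derive1. Qed.

Lemma smooth_derive1n n f : smooth f -> smooth (derive1n n f).
Proof. by move=> sf k x; rewrite /derive1n -iterD; exact: sf. Qed.

Lemma is_derive_derive1n n f x :
  smooth f -> is_derive x 1 (derive1n n f) (derive1n n.+1 f x).
Proof. by move=> sf; rewrite derive1nS derive1E; apply/derivableP/sf. Qed.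

Lemma is_derive_bigsum n (h dh : 'I_n -> R -> R) x :
  (forall i, is_derive x 1 (h i) (dh i x)) ->
  is_derive x 1 (fun y => \sum_(i < n) h i y) (\sum_(i < n) dh i x).
Proof.
move=> hh; have -> : (fun y => \sum_(i < n) h i y) = \sum_(i < n) h i.
  by apply/funext => y; rewrite fct_sumE.
exact: is_derive_sum.
Qed.

Lemma is_derive_scale a f x d :
  is_derive x 1 f d -> is_derive x 1 (fun y => a * f y) (a * d).
Proof. by move=> fd; exact: is_deriveZ. Qed.

(** Linear combinations, products, differences and waves all get their iterated derivatives by
    guessing the whole sequence at once. *)
Lemma derive1n_seq (F : nat -> R -> R) :
  (forall n x, is_derive x 1 (F n) (F n.+1 x)) ->
  forall n, derive1n n (F 0%N) = F n.
Proof.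
move=> dF; elim=> // n IHn; apply/funext => x.
by rewrite derive1nS IHn derive1E (@derive_val _ _ _ _ _ _ _ (dF n x)).
Qed.

Lemma smooth_seq (F : nat -> R -> R) :
  (forall n x, is_derive x 1 (F n) (F n.+1 x)) -> smooth (F 0%N).
Proof.
by move=> dF n x; rewrite derive1n_seq //; apply: (@ex_derive _ _ _ _ _ _ _ (dF n x)).
Qed.

Definition lincomb N (a : 'I_N -> R) (f : 'I_N -> R -> R) n x :=
  \sum_(j < N) a j * derive1n n (f j) x.

Lemma is_derive_lincomb N (a : 'I_N -> R) (f : 'I_N -> R -> R) n x :
  (forall j, smooth (f j)) ->
  is_derive x 1 (lincomb a f n) (lincomb a f n.+1 x).
Proof.
move=> sf; apply: (@is_derive_bigsum _ _ (fun j y => a j * derive1n n.+1 (f j) y)).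
by move=> j; apply/is_derive_scale/is_derive_derive1n.
Qed.

Lemma derive1n_lincomb N (a : 'I_N -> R) (f : 'I_N -> R -> R) n :
  (forall j, smooth (f j)) -> derive1n n (lincomb a f 0) = lincomb a f n.
Proof. by move=> sf; apply: derive1n_seq => k x; exact: is_derive_lincomb. Qed.

Lemma smooth_lincomb N (a : 'I_N -> R) (f : 'I_N -> R -> R) :
  (forall j, smooth (f j)) -> smooth (lincomb a f 0).
Proof. by move=> sf; apply: smooth_seq => k x; exact: is_derive_lincomb. Qed.

Lemma Pascal_sum (A : nat -> nat -> R) n :
  \sum_(i < n.+1) (A i.+1 (n - i)%N + A i (n - i).+1) *+ 'C(n, i) =
  \sum_(i < n.+2) A i (n.+1 - i)%N *+ 'C(n.+1, i).
Proof.
under eq_bigr do rewrite mulrnDl.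
rewrite big_split /= addrC big_ord_recl [RHS]big_ord_recl /=.
rewrite !bin0 !subn0 -addrA; congr (_ + _).
under [RHS]eq_bigr => i _ do rewrite /bump /= add1n subSS binS mulrnDr.
rewrite big_split [X in _ = X + _]big_ord_recr /= bin_small // mulr0n addr0.
congr (_ + _); apply: eq_bigr => i _.
by rewrite /bump /= add1n subnSK.
Qed.

Definition Leibniz f g n x :=
  \sum_(i < n.+1) derive1n i f x * derive1n (n - i) g x *+ 'C(n, i).

Lemma is_derive_Leibniz f g n x : smooth f -> smooth g ->
  is_derive x 1 (Leibniz f g n) (Leibniz f g n.+1 x).
Proof.
move=> sf sg; rewrite /Leibniz.
rewrite -(Pascal_sum (fun i j => derive1n i f x * derive1n j g x)).
apply: (@is_derive_bigsum _ _ (fun (i : 'I_n.+1) y =>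
  (derive1n i.+1 f y * derive1n (n - i) g y +
   derive1n i f y * derive1n (n - i).+1 g y) *+ 'C(n, i))) => i.
rewrite -mulr_natl.
have -> : (fun y => derive1n i f y * derive1n (n - i) g y *+ 'C(n, i)) =
   (fun y => 'C(n, i)%:R * (derive1n i f * derive1n (n - i) g) y).
  by apply/funext => y; rewrite mulr_natl.
apply: is_derive_scale.
apply: is_derive_eq.
  exact: is_deriveM (is_derive_derive1n i x sf) (is_derive_derive1n (n - i) x sg).
by rewrite addrC /GRing.scale /= [X in X + _]mulrC.
Qed.

Lemma derive1nM n f g : smooth f -> smooth g ->
  derive1n n (f * g) = Leibniz f g n.
Proof.
move=> sf sg; have <- : Leibniz f g 0 = f * g.
  by apply/funext => x; rewrite /Leibniz big_ord1 bin0.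
by apply: derive1n_seq => k x; exact: is_derive_Leibniz.
Qed.

Lemma smoothM f g : smooth f -> smooth g -> smooth (f * g).
Proof.
move=> sf sg; have <- : Leibniz f g 0 = f * g.
  by apply/funext => x; rewrite /Leibniz big_ord1 bin0.
by apply: smooth_seq => k x; exact: is_derive_Leibniz.
Qed.

Lemma is_derive_derive1nB n f g x : smooth f -> smooth g ->
  is_derive x 1 (derive1n n f - derive1n n g)
    ((derive1n n.+1 f - derive1n n.+1 g) x).
Proof. by move=> sf sg; apply: is_deriveB; exact: is_derive_derive1n. Qed.

Lemma derive1nB n f g : smooth f -> smooth g ->
  derive1n n (f - g) = derive1n n f - derive1n n g.
Proof.
move=> sf sg; apply: (@derive1n_seq (fun k => derive1n k f - derive1n k g)).
by move=> k x; exact: is_derive_derive1nB.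
Qed.

Lemma smoothB f g : smooth f -> smooth g -> smooth (f - g).
Proof.
move=> sf sg; apply: (@smooth_seq (fun k => derive1n k f - derive1n k g)).
by move=> k x; exact: is_derive_derive1nB.
Qed.

Lemma is_derive_derive1n_axpy a n f g x : smooth f -> smooth g ->
  is_derive x 1 (fun y => a * derive1n n f y + derive1n n g y)
    (a * derive1n n.+1 f x + derive1n n.+1 g x).
Proof.
move=> sf sg; apply: (@is_deriveD _ _ _ (fun y => a * derive1n n f y)).
  exact/is_derive_scale/is_derive_derive1n.
exact: is_derive_derive1n.
Qed.

Lemma derive1n_axpy a n f g : smooth f -> smooth g ->
  derive1n n (fun x => a * f x + g x) =
  fun x => a * derive1n n f x + derive1n n g x.
Proof.
move=> sf sg; apply: (@derive1n_seq
  (fun k x => a * derive1n k f x + derive1n k g x)).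
by move=> k x; exact: is_derive_derive1n_axpy.
Qed.

Lemma vect_S1_vbracket f g : vect_S1 f -> vect_S1 g -> vect_S1 (vbracket f g).
Proof.
move=> [pf sf] [pg sg]; split.
  move=> x; have pf' := periodic_derive1 pf; have pg' := periodic_derive1 pg.
  by rewrite /vbracket /= !fctE pf pg pf' pg'.
have sf' := smooth_derive1n (n := 1) sf.
have sg' := smooth_derive1n (n := 1) sg.
exact: smoothB (smoothM sf sg') (smoothM sf' sg).
Qed.

Lemma derive1n_vbracket n f g x : smooth f -> smooth g ->
  derive1n n (vbracket f g) x = \sum_(i < n.+1)
    (derive1n i f x * derive1n (n - i).+1 g x -
     derive1n i.+1 f x * derive1n (n - i) g x) *+ 'C(n, i).
Proof.
move=> sf sg.
have sf' := smooth_derive1n (n := 1) sf.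
have sg' := smooth_derive1n (n := 1) sg.
rewrite (derive1nB n (smoothM sf sg') (smoothM sf' sg)).
rewrite (derive1nM n sf sg') (derive1nM n sf' sg).
transitivity (Leibniz f (derive1n 1 g) n x - Leibniz (derive1n 1 f) g n x) => //.
rewrite -sumrB.
by apply: eq_bigr => i _; rewrite mulrnBl !derive1Sn.
Qed.

Lemma is_derive_wave (a b w : R) x :
  is_derive x 1 (fun y => a * cos (w * y) + b * sin (w * y))
    (w * b * cos (w * x) - w * a * sin (w * x)).
Proof.
have dw : is_derive x 1 (fun y => w * y) w.
  by have := is_derive_scale w (is_derive_id x 1); rewrite mulr1.
have dc := is_derive1_comp (is_derive_cos (w * x)) dw.
have ds := is_derive1_comp (is_derive_sin (w * x)) dw.
have -> : w * b * cos (w * x) - w * a * sin (w * x) =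
  a * (- sin (w * x) * w) + b * (cos (w * x) * w) by ring.
apply: (@is_deriveD _ _ _ (fun y => a * (cos \o *%R w) y)
                          (fun y => b * (sin \o *%R w) y));
  exact: is_derive_scale.
Qed.

End SmoothFunctions.

Local Open Scope complex_scope.

(** * Composition and bracket of symbols with differential-operator coefficients *)

Section DifferentialSymbols.
Variable R : realType.
Local Notation C := R[i].
Implicit Types (f g : R -> R) (x : R) (q : {poly C}) (Phi : nat -> {poly C}).

Definition jet f x : nat -> C := fun j => (derive1n j f x)%:C.

Lemma diff_opE q f x : diff_op q f x = jet_eval (jet f x) q.
Proof. by []. Qed.

Lemma Re_sum (I : finType) (F : I -> C) :
  complex.Re (\sum_i F i) = \sum_i complex.Re (F i).
Proof. by apply: (big_morph (@complex.Re R)) => // -[a b] [c d]. Qed.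

Lemma Im_sum (I : finType) (F : I -> C) :
  complex.Im (\sum_i F i) = \sum_i complex.Im (F i).
Proof. by apply: (big_morph (@complex.Im R)) => // -[a b] [c d]. Qed.

Lemma Re_diff_op q f : @complex.Re R \o diff_op q f =
  lincomb (fun j : 'I_(size q) => complex.Re q`_j) (fun j => derive1n j f) 0.
Proof.
apply/funext => x; rewrite /= /diff_op /lincomb Re_sum.
by apply: eq_bigr => j _ /=; case: (q`_j) => a b /=; rewrite mulr0 subr0.
Qed.

Lemma Im_diff_op q f : @complex.Im R \o diff_op q f =
  lincomb (fun j : 'I_(size q) => complex.Im q`_j) (fun j => derive1n j f) 0.
Proof.
apply/funext => x; rewrite /= /diff_op /lincomb Im_sum.
by apply: eq_bigr => j _ /=; case: (q`_j) => a b /=; rewrite mulr0 add0r.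
Qed.

Lemma cfun_S1_diff_op q f : vect_S1 f -> cfun_S1 (diff_op q f).
Proof.
move=> [pf sf]; split.
- move=> x; apply: eq_bigr => j _.
  by rewrite (periodic_derive1n j pf).
- by rewrite Re_diff_op; apply: smooth_lincomb => j; exact: smooth_derive1n.
- by rewrite Im_diff_op; apply: smooth_lincomb => j; exact: smooth_derive1n.
Qed.

Lemma cderiv_diff_op q f : smooth f -> cderiv (diff_op q f) = diff_op ('X * q) f.
Proof.
move=> sf; apply/funext => x.
have sd j : smooth (derive1n j f) by exact: smooth_derive1n.
rewrite diff_opE -['X]expr1 jet_eval_mulXn /cderiv Re_diff_op Im_diff_op.
rewrite -derive1n1 (derive1n_lincomb _ 1 (fun j => sd _)).
rewrite -derive1n1 (derive1n_lincomb _ 1 (fun j => sd _)).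
rewrite /lincomb; apply/eqP; rewrite eq_complex /= Re_sum Im_sum; apply/andP; split;
  apply/eqP; apply: eq_bigr => j _; rewrite /jet /= addn1;
  by case: (q`_j) => a b /=; rewrite mulr0 ?subr0 ?add0r.
Qed.

Lemma cfun_S1_0 : cfun_S1 (fun _ : R => 0 : C).
Proof.
have s0 : smooth (fun _ : R => 0 : R).
  by apply: (@smooth_seq _ (fun=> fun=> 0)) => n x; exact: is_derive_cst.
by split.
Qed.

Lemma cderiv0 : cderiv (fun _ : R => 0 : C) = fun _ => 0.
Proof.
by apply/funext => x; rewrite /cderiv !(derive1_cst (0 : R)).
Qed.

Definition diff_symbol Phi f : symbol R := fun k x =>
  if k <= 1 then diff_op (Phi `|1 - k|%N) f x else 0.

Lemma diff_symbol_le Phi f n x :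
  diff_symbol Phi f (1 - n%:Z) x = diff_op (Phi n) f x.
Proof.
rewrite /diff_symbol; have -> : 1 - n%:Z <= 1 by lia.
by congr (diff_op (Phi _) _ _); lia.
Qed.

Lemma diff_symbol_gt Phi f k : 1 < k -> diff_symbol Phi f k = fun=> 0.
Proof. by move=> k1; apply/funext => x; rewrite /diff_symbol leNgt k1. Qed.

Lemma psiD_diff_symbol Phi f : vect_S1 f -> psiD (diff_symbol Phi f).
Proof.
move=> vf; split; last by exists 1; exact: diff_symbol_gt.
move=> k; have [k1|k1] := leP k 1; last by rewrite diff_symbol_gt //; exact: cfun_S1_0.
have -> : k = 1 - `|1 - k|%N%:Z by lia.
have -> : diff_symbol Phi f (1 - `|1 - k|%N%:Z) = diff_op (Phi `|1 - k|%N) f.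
  by apply/funext => x; exact: diff_symbol_le.
exact: cfun_S1_diff_op.
Qed.

Lemma iter_dx_diff_symbol k Phi f : smooth f ->
  iter k (@dx R) (diff_symbol Phi f) = diff_symbol (fun i => 'X^k * Phi i) f.
Proof.
move=> sf; elim: k => [|k IHk] /=.
  by congr diff_symbol; apply/funext => i; rewrite expr0 mul1r.
rewrite IHk /dx; apply/funext => l; have [l1|l1] := leP l 1; last first.
  by rewrite !diff_symbol_gt // cderiv0.
have -> : l = 1 - `|1 - l|%N%:Z by lia.
have E Psi : diff_symbol Psi f (1 - `|1 - l|%N%:Z) = diff_op (Psi `|1 - l|%N) f.
  by apply/funext => x; exact: diff_symbol_le.
by rewrite !E cderiv_diff_op // exprS mulrA.
Qed.

(** The falling factorial (l + k)...(l + 1) is expressed through [gbinom] so that its factorial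
    cancels the one in [scomp]. *)
Lemma iter_dxi k (G : symbol R) l x : iter k (@dxi R) G l x =
  k`!%:R * gbinom (l + k%:Z)%:~R k * G (l + k%:Z) x.
Proof.
elim: k l => [|k IHk] l; first by rewrite /= gbinom0 fact0 !mul1r addr0.
rewrite /= /dxi IHk -addrA -intS mulrA; congr (_ * _).
have := gbinomS ((l + k.+1%:Z)%:~R : C) k; rewrite factS natrM.
move: (gbinom _ k) (gbinom _ k.+1) => a b gS.
transitivity (k`!%:R * (k.+1%:R * b)); last by ring.
have -> : (l + 1)%:~R = (l + k.+1%:Z)%:~R - k%:R :> C.
  by rewrite -[k%:R]/(k%:Z%:~R) -rmorphB; congr (_%:~R); lia.
by rewrite gS; ring.
Qed.

Lemma smul_finite (A B : symbol R) (a b : int) n x :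
  (forall l, a < l -> A l x = 0) -> (forall l, b < l -> B l x = 0) ->
  smul A B (a + b - n%:Z) x =
  \sum_(i < n.+1) A (a - i%:Z) x * B (b - (n - i)%N%:Z) x.
Proof.
move=> A0 B0; rewrite /smul (@fsbigE _ _ _ _ _ [seq a - i%:Z | i <- iota 0 n.+1]).
- rewrite big_map (eq_bigl xpredT) => [|i]; last by rewrite mem_set.
  rewrite -[iota 0 _]/(index_iota 0 n.+1) big_mkord; apply: eq_bigr => i _.
  by have lt_in := ltn_ord i; congr (_ * B _ _); lia.
- by rewrite map_inj_uniq ?iota_uniq // => i j /= ; lia.
- by [].
- move=> l _ lr; have [al|la] := ltP a l; first by rewrite A0 ?mul0r.
  rewrite B0 ?mulr0 // ltNge; apply: contra lr => h.
  apply/mapP; exists `|a - l|%N; rewrite ?mem_iota; lia.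
Qed.

Lemma smul_eq0 (A B : symbol R) (a b : int) m x :
  (forall l, a < l -> A l x = 0) -> (forall l, b < l -> B l x = 0) ->
  a + b < m -> smul A B m x = 0.
Proof.
move=> A0 B0 abm; apply: fsbig1 => l _.
have [al|la] := ltP a l; first by rewrite A0 ?mul0r.
by rewrite B0 ?mulr0 //; lia.
Qed.

Lemma iter_dxi_diff_symbol_gt k Phi f l x : 1 - k%:Z < l ->
  iter k (@dxi R) (diff_symbol Phi f) l x = 0.
Proof. by move=> kl; rewrite iter_dxi diff_symbol_gt ?mulr0 //; lia. Qed.

Lemma scomp_diff_symbol Phi f g n x : smooth g ->
  scomp (diff_symbol Phi f) (diff_symbol Phi g) (2 - n%:Z) x =
  jet_comp Phi n (jet f x) (jet g x).
Proof.
(* After k derivatives in xi the product has order at most 2 - k, so the terms with k > n do not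
   reach xi^(2 - n). *)
move=> sg; rewrite /scomp (@fsbigE _ _ _ _ _ (iota 0 n.+1)) ?iota_uniq //; last first.
  move=> k _; rewrite mem_iota add0n leq0n /= -leqNgt => nk.
  rewrite (@smul_eq0 _ _ (1 - k%:Z) 1) ?mulr0 //; last by lia.
  - by move=> l; exact: iter_dxi_diff_symbol_gt.
  - by move=> l l1; rewrite iter_dx_diff_symbol // diff_symbol_gt.
rewrite (eq_bigl xpredT) => [|i]; last by rewrite mem_set.
rewrite -[iota 0 _]/(index_iota 0 n.+1) big_mkord.
pose G k i := gbinom (1 - i%:R) k * (jet_eval (jet f x) (Phi i) *
  jet_eval (jet g x) ('X^k * Phi (n - (k + i))%N)) : C.
transitivity (\sum_(k < n.+1) \sum_(i < (n - k).+1) G k i); last first.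
  rewrite big_triangle; apply: eq_bigr => m _; apply: eq_bigr => i _.
  by rewrite /G subnK // -ltnS.
apply: eq_bigr => k _; have kn : (k <= n)%N by rewrite -ltnS.
have -> : 2 - n%:Z = (1 - k%:Z) + 1 - (n - k)%N%:Z by lia.
rewrite smul_finite; last 2 first.
- by move=> l; exact: iter_dxi_diff_symbol_gt.
- by move=> l l1; rewrite iter_dx_diff_symbol // diff_symbol_gt.
rewrite mulr_sumr; apply: eq_bigr => i _; rewrite iter_dxi iter_dx_diff_symbol //.
have -> : 1 - k%:Z - i%:Z + k%:Z = 1 - i%:Z by lia.
rewrite !diff_symbol_le !diff_opE.
have -> : (1 - i%:Z)%:~R = 1 - i%:R :> C by rewrite intrB.
rewrite /G subnDA.
have kf : k`!%:R != 0 :> C by rewrite pnatr_eq0 -lt0n fact_gt0.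
by rewrite !mulrA mulVf // mul1r.
Qed.

Lemma scomp_diff_symbol_gt Phi f g k x : smooth g -> 2 < k ->
  scomp (diff_symbol Phi f) (diff_symbol Phi g) k x = 0.
Proof.
move=> sg k2; apply: fsbig1 => j _.
rewrite (@smul_eq0 _ _ (1 - j%:Z) 1) ?mulr0 //; last by lia.
- by move=> l; exact: iter_dxi_diff_symbol_gt.
- by move=> l l1; rewrite iter_dx_diff_symbol // diff_symbol_gt.
Qed.

Lemma jet_vbracket f g x : smooth f -> smooth g ->
  jet (vbracket f g) x = bracket_jet (jet f x) (jet g x).
Proof.
move=> sf sg; apply/funext => j; rewrite /jet derive1n_vbracket // rmorph_sum.
by apply: eq_bigr => i _; rewrite raddfMn /= rmorphB /= !rmorphM.
Qed.

Lemma diff_symbol_bracket Phi f g n x : smooth f -> smooth g ->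
  diff_symbol Phi (vbracket f g) (2 - n%:Z) x =
  jet_pair (jet f x) (jet g x)
    (symbol_target (constPP C) Phi n 'X%:P 'X).
Proof.
move=> sf sg; case: n => [|n] /=; first by rewrite jet_pair0 diff_symbol_gt.
rewrite jet_pair_target -jet_vbracket // -diff_opE -diff_symbol_le.
by congr (diff_symbol _ _ _ _); lia.
Qed.

Lemma sbracketE (A B : symbol R) k x :
  sbracket A B k x = scomp A B k x - scomp B A k x.
Proof. by []. Qed.

Lemma diff_symbol_hom Phi f g : symbol_hom (constPP C) Phi 'X%:P 'X ->
  smooth f -> smooth g ->
  diff_symbol Phi (vbracket f g) = sbracket (diff_symbol Phi f) (diff_symbol Phi g).
Proof.
move=> hom sf sg; apply/funext => k; apply/funext => x; rewrite sbracketE.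
have [k2|k2] := leP k 2; last first.
  by rewrite !scomp_diff_symbol_gt // subrr diff_symbol_gt //; lia.
have -> : k = 2 - `|2 - k|%N%:Z by lia.
rewrite diff_symbol_bracket // -hom jet_pairB jet_pair_compXY jet_pair_compYX.
by rewrite !scomp_diff_symbol.
Qed.

(** * Trigonometric test fields *)

Definition wave (a b w x : R) : R := a * cos (w * x) + b * sin (w * x).

(** The wave is the real part of (a - ib) e^(iwx), and each derivative multiplies the amplitude by
    iw. *)
Lemma derive1n_wave n a b w :
  derive1n n (wave a b w) = wave
    (complex.Re ((a -i* b) * (w *i) ^+ n)) (- complex.Im ((a -i* b) * (w *i) ^+ n)) w.
Proof.
pose F k := wave (complex.Re ((a -i* b) * (w *i) ^+ k))
  (- complex.Im ((a -i* b) * (w *i) ^+ k)) w.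
have <- : F 0%N = wave a b w by rewrite /F expr0 mulr1 /= opprK.
apply: derive1n_seq => k x.
have := is_derive_wave (complex.Re ((a -i* b) * (w *i) ^+ k))
  (- complex.Im ((a -i* b) * (w *i) ^+ k)) w x.
congr is_derive; rewrite /F /wave exprSr mulrA.
by case: ((a -i* b) * (w *i) ^+ k) => c d /=; ring.
Qed.

Lemma vect_S1_wave a b (m : nat) : vect_S1 (wave a b m%:R).
Proof.
split.
  move=> x; rewrite /wave.
  have -> : m%:R * (x + 2 * pi) = m%:R * x + pi *+ 2 *+ m.
    by rewrite (mulrDr m%:R x) [_ * (2 * pi)]mulr_natl [2 * pi]mulr_natl.
  by rewrite (periodicn (@cosD2pi R)) (periodicn (@sinD2pi R)).
move=> n x; rewrite derive1n_wave.
exact: (@ex_derive _ _ _ _ _ _ _ (is_derive_wave _ _ _ x)).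
Qed.

Lemma jet_wave a b w :
  jet (wave a b w) 0 = fun j => (complex.Re ((a -i* b) * (w *i) ^+ j))%:C.
Proof.
apply/funext => j; rewrite /jet derive1n_wave /wave !mulr0 cos0 sin0.
by rewrite mulr1 mulr0 addr0.
Qed.

Lemma exp_jet_wave w :
  (fun j => (w *i) ^+ j) =
  (fun j => jet (wave 1 0 w) 0 j + 'i * jet (wave 0 1 w) 0 j).
Proof.
apply/funext => j; rewrite !jet_wave.
by case: ((w *i) ^+ j) => c d; apply/eqP; rewrite eq_complex /=; apply/andP; split;
  apply/eqP; ring.
Qed.

(** Tested at the point 0 on cosines and sines, the bracket identity makes [D] vanish on pairs of
    exponential jets, since the pairing is complex bilinear; [jet_pair_eq0] then makes it a
    polynomial identity. *)
Lemma diff_symbol_hom_necessary Phi :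
  (forall f g, vect_S1 f -> vect_S1 g ->
     diff_symbol Phi (vbracket f g) =
     sbracket (diff_symbol Phi f) (diff_symbol Phi g)) ->
  symbol_hom (constPP C) Phi 'X%:P 'X.
Proof.
move=> hom n; apply/eqP; rewrite -subr_eq0; apply/eqP; set D := _ - _.
have D0 f g : vect_S1 f -> vect_S1 g -> jet_pair (jet f 0) (jet g 0) D = 0.
  move=> vf vg; have [_ sf] := vf; have [_ sg] := vg.
  have /(congr1 (fun F : symbol R => F (2 - n%:Z) 0)) := hom _ _ vf vg.
  rewrite sbracketE diff_symbol_bracket // => e.
  rewrite /D !jet_pairB e jet_pair_compXY jet_pair_compYX.
  by rewrite -!scomp_diff_symbol // subrr.
have i0 : ('i : C) != 0 by rewrite eq_complex /= oner_eq0 andbF.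
apply: (jet_pair_eq0 i0) => m k.
have natE (l : nat) : (fun j => (l%:R * 'i : C) ^+ j) = fun j => (l%:R *i) ^+ j.
  by apply/funext => j; congr (_ ^+ _); rewrite -(rmorph_nat (real_complex R)) /=;
     apply/eqP; rewrite eq_complex /=; apply/andP; split; apply/eqP; ring.
rewrite !natE !exp_jet_wave jet_pair_combl !jet_pair_combr.
rewrite !D0; try exact: vect_S1_wave.
by rewrite !(mulr0, addr0).
Qed.

End DifferentialSymbols.

(** * Normal forms, recovery of the parameters, and the polynomial deformation *)

Section DeformationFamily.
Variable R : realType.
Local Notation C := R[i].
Implicit Types (f g : R -> R) (x : R) (c mu lam alpha tau : C).

Definition normal_symbol c0 c1 (A : nat -> {poly C}) n : {poly C} :=
  if n is m.+1 then (if m is _.+1 then A m else c0%:P + c1 *: 'X) else 1.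

Lemma diff_op1 f x : diff_op 1 f x = (f x)%:C.
Proof. by rewrite diff_opE -(expr0 'X) jet_evalXn. Qed.

Lemma diff_op_deg1 c0 c1 f x :
  diff_op (c0%:P + c1 *: 'X) f x = c0 * (f x)%:C + c1 * (derive1 f x)%:C.
Proof.
rewrite diff_opE jet_evalD -mul_polyC -[c0%:P]mulr1 !mul_polyC !jet_evalZ.
by rewrite -(expr0 'X) -{2}['X]expr1 !jet_evalXn.
Qed.

Lemma normal_formE c0 c1 A f :
  normal_form c0 c1 A f = diff_symbol (normal_symbol c0 c1 A) f.
Proof.
apply/funext => k; apply/funext => x; have [k1|k1] := leP k 1; last first.
  by rewrite diff_symbol_gt // /normal_form !ifF //; lia.
have -> : k = 1 - `|1 - k|%N%:Z by lia.
rewrite diff_symbol_le /normal_form; case: (`|1 - k|%N) => [|[|n]] /=.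
- by rewrite diff_op1.
- by rewrite diff_op_deg1.
by congr (diff_op (A _) _ _); lia.
Qed.

Lemma infinitesimal_coef0 c0 c1 c2 c3 f x :
  infinitesimal_deformation c0 c1 c2 c3 f 0 x =
  c0 * (f x)%:C + c1 * (derive1 f x)%:C.
Proof.
rewrite /infinitesimal_deformation /std_embedding /theta0 /theta1 /theta2 /theta3.
by rewrite /= !mulr0 !addr0 add0r.
Qed.

Lemma infinitesimal_coefN1 c0 c1 c2 c3 f x :
  infinitesimal_deformation c0 c1 c2 c3 f (-1) x = c2 * (derive1n 2 f x)%:C.
Proof.
rewrite /infinitesimal_deformation /std_embedding /theta0 /theta1 /theta2 /theta3.
by rewrite /= !mulr0 !addr0 !add0r; field.
Qed.

Lemma infinitesimal_coefN2 c0 c1 c2 c3 f x :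
  infinitesimal_deformation c0 c1 c2 c3 f (-2) x = c3 * (derive1n 3 f x)%:C.
Proof.
rewrite /infinitesimal_deformation /std_embedding /theta0 /theta1 /theta2 /theta3.
by rewrite /= !mulr0 !addr0 !add0r; field.
Qed.

(** [corresponds_to_polynomial_deformation] quantifies over the parameters anew, so they must be
    recovered from the map. At the point 0 the sine isolates c1 in xi^0 and c3 in xi^(-2), and the
    cosine isolates c2 in xi^(-1). *)
Lemma infinitesimal_inj c0 c1 c2 c3 d0 d1 d2 d3 :
  (forall f, vect_S1 f -> infinitesimal_deformation c0 c1 c2 c3 f =
                          infinitesimal_deformation d0 d1 d2 d3 f) ->
  [/\ c1 = d1, c2 = d2 & c3 = d3].
Proof.
move=> cd; have vw a b : vect_S1 (wave a b 1 : R -> R).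
  exact: (vect_S1_wave a b 1).
have at0 f k : vect_S1 f -> infinitesimal_deformation c0 c1 c2 c3 f k 0 =
    infinitesimal_deformation d0 d1 d2 d3 f k 0 by move=> /cd ->.
have jw a b j : (derive1n j (wave a b 1 : R -> R) 0)%:C =
    (complex.Re ((a -i* b) * 'i ^+ j))%:C.
  by have /(congr1 (fun J => J j)) := jet_wave a b (1 : R).
(* This is the value at 0 of both cos'' and sin'''. *)
have nz : ((-1 : R)%:C : C) != 0 by rewrite eq_complex /= oppr_eq0 oner_eq0.
split.
- have := at0 _ 0 (vw 0 1); rewrite !infinitesimal_coef0.
  rewrite -derive1n1 -[wave 0 1 1 0]/(derive1n 0 (wave 0 1 1) 0) !jw.
  rewrite expr0 expr1 /= !(mul0r, mulr0, mulr1, mul1r, subr0, sub0r, opprK).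
  by rewrite oppr0 !mulr0 !add0r.
- have := at0 _ (-1) (vw 1 0); rewrite !infinitesimal_coefN1 !jw expr2 /=.
  rewrite !(mul0r, mulr0, mulr1, mul1r, subr0, sub0r, opprK, oppr0, addr0).
  exact: mulIf.
- have := at0 _ (-2) (vw 0 1); rewrite !infinitesimal_coefN2 !jw !exprS expr0 /=.
  rewrite !(mul0r, mulr0, mulr1, mul1r, subr0, sub0r, opprK, oppr0, addr0, add0r).
  rewrite !(mulrN, mulr1, mulr0, opprK, oppr0).
  exact: mulIf.
Qed.

Lemma deformation_necessary n p (t : 'rV[C]_n) c0 c1 A :
  polynomial_deformation p ->
  (forall f, vect_S1 f -> deformed p t f = normal_form c0 c1 A f) ->
  deformation_poly c1 (A 1%N)`_2 (A 2%N)`_3 = 0.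
Proof.
move=> [hom _ _ _ _] pE; have [_ _ brk] := hom t.
pose Phi := normal_symbol c0 c1 A.
have PhiE f : vect_S1 f -> deformed p t f = diff_symbol Phi f.
  by move=> vf; rewrite pE // normal_formE.
have Phi_hom : symbol_hom (constPP C) Phi 'X%:P 'X.
  apply: diff_symbol_hom_necessary => f g vf vg.
  rewrite -(PhiE _ (vect_S1_vbracket vf vg)) -(PhiE _ vf) -(PhiE _ vg).
  exact: brk.
have size1 : (size (Phi 1%N) <= 2)%N.
  rewrite (leq_trans (size_polyD _ _)) // geq_max (leq_trans (size_polyC_leq1 _)) //.
  by rewrite (leq_trans (size_scale_leq _ _)) // size_polyX.
have := deformation_poly_necessary Phi_hom erefl size1.
by rewrite /Phi /= coefD coefC coefZ coefX /= add0r mulr1.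
Qed.

(** [mu1] and [mu2] are the roots of mu^2 - (2 c1 - 1) mu + 2 c2, the c2-equation with lam = c1 -
    mu. The hypothesis says only that one of them solves the c3-equation, so [param] is stated
    symmetrically and applied to whichever does. *)
Lemma deformation_parameters c1 c2 c3 : deformation_poly c1 c2 c3 = 0 ->
  exists mu lam, [/\ mu + lam = c1, gbinom mu 2 + lam * mu = c2
                   & gbinom mu 3 + lam * gbinom mu 2 = c3].
Proof.
move=> P0; pose s := 2 * c1 - 1; pose delta := sqrtc (s ^+ 2 - 8 * c2).
have dE : delta ^+ 2 = s ^+ 2 - 8 * c2 by exact: sqr_sqrtc.
pose mu1 := (s + delta) / 2; pose mu2 := (s - delta) / 2.
have hs : mu1 + mu2 = s by rewrite /mu1 /mu2; field.
have hp : mu1 * mu2 = 2 * c2.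
  have -> : mu1 * mu2 = (s ^+ 2 - delta ^+ 2) / 4 by rewrite /mu1 /mu2; field.
  by rewrite dE; field.
have param mu mu' : mu + mu' = s -> mu * mu' = 2 * c2 ->
    gbinom mu 3 + (c1 - mu) * gbinom mu 2 - c3 = 0 ->
    exists mu lam, [/\ mu + lam = c1, gbinom mu 2 + lam * mu = c2
                     & gbinom mu 3 + lam * gbinom mu 2 = c3].
  move=> es ep e3; exists mu, (c1 - mu); split; first by ring.
    have -> : c2 = mu * mu' / 2 by rewrite ep; field.
    have -> : c1 = (mu + mu' + 1) / 2 by rewrite es /s; field.
    by rewrite gbinom2; field.
  by apply/eqP; rewrite -subr_eq0; apply/eqP.
have /eqP := deformation_poly_resultant c3 hs hp.
rewrite P0 mul0r mulf_eq0 => /orP [] /eqP; first exact: param hs hp.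
by rewrite addrC in hs; rewrite mulrC in hp; exact: param hs hp.
Qed.

Section Deformation.
Variables mu lam alpha : C.

Definition family_at tau := deformation_symbol (tau * mu) (tau * lam) (tau * alpha).

(** [deformed] supplies the term f xi itself, so the tail starts at xi^0. *)
Definition family_tail tau (k : int) : {poly C} :=
  if k <= 0 then family_at tau `|1 - k|%N else 0.

Definition family_deformation (k : int) (t : 'rV[C]_1) f : R -> C :=
  diff_op (family_tail (t 0 0) k) f.

Lemma family0 tau : family_at tau 0 = 1.
Proof.
apply/polyP => -[|k]; rewrite coef_poly coef1 //=.
by rewrite !gbinom0 expr0 /base_coef gbinom0 mulr0 addr0 !mulr1.
Qed.

Lemma family_tail0 k : family_tail 0 k = 0.
Proof.
rewrite /family_tail; case: ifP => // k0.
have -> : `|1 - k|%N = `|k|.+1 by lia.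
apply/polyP => j; rewrite coef_poly coef0; case: ifP => // _.
rewrite /base_coef !mul0r addr0; case: j => [|j].
  by rewrite subn0 expr0n mulr0 mul0r.
by rewrite gbinom0S mulr0.
Qed.

Lemma deformed_family t f :
  deformed family_deformation t f = diff_symbol (family_at (t 0 0)) f.
Proof.
apply/funext => k; apply/funext => x; rewrite /deformed /std_embedding.
rewrite /family_deformation /family_tail.
have op0 : diff_op (0 : {poly C}) f x = 0 by rewrite diff_opE jet_eval0.
have [k0|k0] := leP k 0.
  by rewrite ifF ?add0r; [rewrite /diff_symbol ifT //; lia | lia].
rewrite op0 addr0; case: eqP => [->|k1].
  by rewrite -[1 in RHS]subr0 diff_symbol_le family0 diff_op1.
by rewrite diff_symbol_gt //; lia.
Qed.

Lemma jet_axpy (a : R) f g x : smooth f -> smooth g ->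
  jet (fun y => a * f y + g y) x = fun j => jet g x j + a%:C * jet f x j.
Proof.
move=> sf sg; apply/funext => j.
by rewrite /jet derive1n_axpy // addrC rmorphD rmorphM.
Qed.

Lemma diff_op_linear q : linear_to_cfun (@diff_op R q).
Proof.
split=> [f|a f g]; first exact: cfun_S1_diff_op.
move=> [_ sf] [_ sg] x.
by rewrite !diff_opE jet_axpy // jet_eval_comb addrC.
Qed.

Lemma lie_hom_diff_symbol Phi : symbol_hom (constPP C) Phi 'X%:P 'X ->
  lie_hom (@diff_symbol R Phi).
Proof.
move=> hom; split=> [f|a f g vf vg k x|f g [_ sf] [_ sg]].
- exact: psiD_diff_symbol.
- have [_ lin] := diff_op_linear (Phi `|1 - k|%N).
  rewrite /diff_symbol; case: ifP => // _; first exact: lin.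
  by rewrite mulr0 addr0.
- exact: diff_symbol_hom.
Qed.

Lemma family_tail_poly k : exists N (Q : nat -> {poly C}),
  forall tau, family_tail tau k = \poly_(j < N) (Q j).[tau].
Proof.
have [k0|k0] := boolP (k <= 0); last first.
  exists 0%N, (fun _ => 0) => tau; rewrite /family_tail (negPf k0).
  by apply/polyP => j; rewrite coef0 coef_poly.
set n := `|1 - k|%N.
have [B BE] : exists B : nat -> {poly C},
    forall tau j, (B j).[tau] = gbinom (tau * mu) j.
  (* [gbinom (tau * mu) j] is a falling factorial in tau mu, hence a polynomial in tau. *)
  exists (fun j => j`!%:R^-1 *: \prod_(i < j) (mu *: 'X - i%:R%:P)) => tau j.
  rewrite hornerZ horner_prod mulrC; congr (_ / _); apply: eq_bigr => i _.
  by rewrite hornerD hornerN hornerZ hornerX hornerC mulrC.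
pose Q j := gbinom (1 - j%:R) (n - j) *: (alpha *: 'X) ^+ (n - j) *
  (B j + lam *: 'X * (if j is l.+1 then B l else 0)).
exists n.+1, Q => tau; rewrite /family_tail k0; apply: eq_poly => j _.
rewrite !(hornerM, hornerD, hornerZ, horner_exp, hornerX).
rewrite BE /base_coef [alpha * _]mulrC [lam * _]mulrC.
by case: j => [|j]; rewrite ?horner0 ?BE.
Qed.

Lemma family_deformation_polynomial k : polynomial_family (family_deformation k).
Proof.
have [N [Q QE]] := family_tail_poly k.
exists (\max_(j < N) size (Q j))%N; set d := (\max_(j < N) _)%N.
exists (fun m : {ffun 'I_1 -> 'I_d.+1} => diff_op (\poly_(j < N) (Q j)`_(m ord0))); split.
  by move=> m; exact: diff_op_linear.
move=> t f vf x; rewrite /family_deformation QE.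
(* With one parameter, a multi-exponent is a single exponent of tau. *)
rewrite (reindex (fun e : 'I_d.+1 => [ffun _ : 'I_1 => e])); last first.
  exists (fun m : {ffun 'I_1 -> 'I_d.+1} => m ord0) => m _; first by rewrite ffunE.
  by apply/ffunP => i; rewrite ffunE (ord1 i).
rewrite diff_opE (jet_eval_wide _ (size_poly _ _)).
under [RHS]eq_bigr => e _ do
  rewrite big_ord1 !ffunE diff_opE (jet_eval_wide _ (size_poly _ _)) mulr_sumr.
rewrite exchange_big; apply: eq_bigr => j _ /=.
rewrite coef_poly ltn_ord (@horner_coef_wide _ d.+1); last first.
  exact: leqW (@leq_bigmax _ (fun j : 'I_N => size (Q j)) j).
rewrite mulr_suml; apply: eq_bigr => e _.
by rewrite coef_poly ltn_ord; ring.
Qed.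

Lemma family_polynomial_deformation : polynomial_deformation family_deformation.
Proof.
split.
- move=> t; have -> : deformed family_deformation t = diff_symbol (family_at (t 0 0)).
    by apply/funext => f; exact: deformed_family.
  exact/lie_hom_diff_symbol/deformation_symbol_hom.
- by move=> k t; exact: diff_op_linear.
- exact: family_deformation_polynomial.
- move=> k f _; apply/funext => x.
  by rewrite /family_deformation mxE family_tail0 diff_opE jet_eval0.
- exists 0 => k k0 t f _; apply/funext => x.
  by rewrite /family_deformation /family_tail leNgt k0 /= diff_opE jet_eval0.
Qed.

Lemma family_normal_form f :
  deformed family_deformation (const_mx 1) f =
  normal_form alpha (mu + lam) (fun k => family_at 1 k.+1) f.
Proof.
rewrite normal_formE deformed_family mxE; congr diff_symbol.
apply/funext => -[|[|n]] //=; first exact: family0.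
apply/polyP => j; rewrite coef_poly coefD coefC coefZ coefX !mul1r.
case: j => [|[|j]] //=; last by rewrite mulr0 addr0.
- by rewrite subn0 subr0 gbinom1 mul1r expr1 /base_coef gbinom0 !mulr0 !addr0 mulr1.
- by rewrite subnn gbinom0 expr0 !mul1r /base_coef gbinom1 gbinom0 !mulr1 add0r.
Qed.

End Deformation.
End DeformationFamily.

Theorem theorem7p1 (R : realType) (c0 c1 c2 c3 : R[i]) :
  corresponds_to_polynomial_deformation
    (infinitesimal_deformation c0 c1 c2 c3) <->
  6 * c1 ^+ 3 * c3 - 3 * c1 ^+ 2 * c2 ^+ 2 - 18 * c1 * c2 * c3
    + 8 * c2 ^+ 3 + 9 * c3 ^+ 2 + 3 * c1 ^+ 3 * c2 - 6 * c1 * c2 ^+ 2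
    - 9 * c1 ^+ 2 * c3 + 18 * c2 * c3 + 3 * c1 * c3
    - 5 * c1 ^+ 2 * c2 + 8 * c2 ^+ 2 + 2 * c1 * c2 = 0.
Proof.
split=> [[d0 [d1 [d2 [d3 [cd [n [p [p_def [t [A [pE A2 A3]]]]]]]]]]]|P0].
  have [-> -> ->] := infinitesimal_inj cd.
  by rewrite -A2 -A3; exact: deformation_necessary p_def pE.
have [mu [lam [<- e2 e3]]] := deformation_parameters P0.
exists c0, (mu + lam), c2, c3; split=> //.
(* c0 enters as the translation alpha, which the polynomial leaves unconstrained. *)
exists 1%N, (family_deformation mu lam c0).
split; first exact: family_polynomial_deformation.
exists (const_mx 1), (fun k => family_at mu lam c0 1 k.+1); split.
- by move=> f _; exact: family_normal_form.
(* A leading coefficient carries alpha^0, so it is [base_coef], here equal to c2 by [e2]; the next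
   goal uses [e3] likewise. *)
- by rewrite coef_poly /= subnn gbinom0 expr0 !mul1r /base_coef gbinom1.
- by rewrite coef_poly /= subnn gbinom0 expr0 !mul1r.
Qed.
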